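(* Let $\mathbb{F}_q$ be the finite field with $q$ elements, $d\ge2$, and $t\in\mathbb{F}_q\setminus\{0\}$. Let $f,g:\mathbb{F}_q^d\times\mathbb{F}_q^d\to\mathbb{R}$ be nonnegative, and set $F(x)=\sum_y f(x,y)$, $G(z)=\sum_w g(z,w)$, $F'(y)=\sum_x f(x,y)$, $G'(w)=\sum_z g(z,w)$. Then $$\left|\sum_{\|x-z\|=\|w-y\|=t}f(x,y)g(z,w)-q^{-2}\|f\|_1\|g\|_1\right|\le 3q^{-\frac{d+2}{2}}\|f\|_1\|g\|_1+4q^{d-1}\|f\|_2\|g\|_2+4q^{\frac{d-3}{2}}\left(\|F\|_2\|G\|_2+\|F'\|_2\|G'\|_2\right).$$ In the case $d=2$ one has $$\left|\sum_{\|x-z\|=\|w-y\|=t}f(x,y)g(z,w)-q^{-2}\|f\|_1\|g\|_1\right|\le 3q^{-3}\|f\|_1\|g\|_1+4q\|f\|_2\|g\|_2+4q^{-\frac12}\left(\|F\|_2\|G\|_2+\|F'\|_2\|G'\|_2\right).$$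
   Context: $\|x\|=x_1^2+\dots+x_d^2$ for $x\in\mathbb{F}_q^d$; the sum on the left runs over all $x,y,z,w\in\mathbb{F}_q^d$ with $\|x-z\|=t$ and $\|w-y\|=t$. For a function $h$ on a finite set, $\|h\|_1=\sum|h|$ and $\|h\|_2=(\sum|h|^2)^{1/2}$ (sums over all points, no normalization).
   Formalization: The formal theorem assumes q is odd. For even q the claim fails: with d=2, q=8, s²=t, f the indicator of x₁+x₂=0, y₁+y₂=0 and g that of z₁+z₂=s, w₁+w₂=s, the left side is 4032 and the right side is about 3688. *)

(* Defs.v *)
From mathcomp Require Import all_boot all_order all_algebra.
From mathcomp Require Import reals exp.

Set Implicit Arguments.
Unset Strict Implicit.
Unset Printing Implicit Defensive.

Import GRing.Theory Num.Theory.
Local Open Scope ring_scope.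

(* ||x|| = x_1^2 + ... + x_d^2, an element of the field K (not a real norm). *)
Definition sqnorm (K : finFieldType) (d : nat) (x : 'rV[K]_d) : K :=
  \sum_(i < d) x ord0 i ^+ 2.

(* Unnormalized (counting measure) norms. *)
Definition l1norm (R : realType) (T : finType) (h : T -> R) : R :=
  \sum_(x : T) `|h x|.

Definition l2norm (R : realType) (T : finType) (h : T -> R) : R :=
  Num.sqrt (\sum_(x : T) `|h x| ^+ 2).

Definition marginal1 (R : realType) (S T : finType) (f : S * T -> R) (x : S) : R :=
  \sum_(y : T) f (x, y).

Definition marginal2 (R : realType) (S T : finType) (f : S * T -> R) (y : T) : R :=
  \sum_(x : S) f (x, y).

Definition distance_sum (R : realType) (K : finFieldType) (d : nat) (t : K)
    (f g : 'rV[K]_d * 'rV[K]_d -> R) : R :=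
  \sum_(x : 'rV[K]_d) \sum_(y : 'rV[K]_d) \sum_(z : 'rV[K]_d)
    \sum_(w : 'rV[K]_d | (sqnorm (x - z) == t) && (sqnorm (w - y) == t))
      f (x, y) * g (z, w).

(* Main.v *)
Require Import Defs.
From mathcomp Require Import all_boot all_order all_algebra all_field.
From mathcomp Require Import reals exp complex.
From mathcomp Require Import zify ring lra.

(** Write the adjacency kernel of [||x - z|| = t] as [c + E], where [c] is the density of the
    sphere, so that [E] has mean zero. Expanding the product of the two kernels leaves the main
    term [c^2 ||f||_1 ||g||_1], two forms in the marginals and one form in [E (x) E]; all are
    bounded by Cauchy-Schwarz once the convolution operator [E] is known to have norm at most
    [2 q^((d-1)/2)]. Its eigenvalues are [q^-1] times Gauss-sum twisted Kloosterman sums. For odd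
    [d] these are Salie sums, which are evaluated; for even [d] they are Kloosterman sums and need
    the Weil bound [2 sqrt q].

    The Weil bound comes from the tower of fields with [q^(2^j)] elements. The Kloosterman sums
    [K_j] along it satisfy [K_(j+1) = 2 q^(2^j) - K_j^2], so that [K_0^2 > 4 q] would make
    [K_j^2 / q^(2^j)] unbounded, while Stepanov's method bounds this quotient independently
    of [j]. *)

Set Implicit Arguments.
Unset Strict Implicit.
Unset Printing Implicit Defensive.

Import Order.TTheory GRing.Theory Num.Theory.
Local Open Scope ring_scope.

(** * Stepanov's method *)

(** Stepanov's argument only bounds from above the number of points with a prescribed trace, and it
    loses a factor depending on the base field. Both defects are harmless. The counts have a known
    total and a nontrivial character sums to zero, so upper bounds alone control the Kloosterman
    sum; and a loss that stays fixed along the tower is beaten by an excess of [K_j^2 / q^(2^j)]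
    over 4 that grows at least fourfold at each step.

    The recursion takes the place of the rationality of an L-function. It comes from listing the
    monic quadratics over a finite field through ordered pairs of roots in that field and through
    conjugate pairs in its quadratic extension: together these meet every quadratic exactly twice.

    Odd characteristic enters through completing the square and through halving, which keeps
    characters nontrivial up the tower. In dimension two the sphere has a more precisely known size,
    which is why its first error term is smaller than the general formula gives. *)

(** Among the terms with nonzero coefficient exactly one has the largest degree, and its leading
    term cannot cancel. *)
Lemma sum_scale_neq0 (F : fieldType) (T : finType) (c : T -> F) (P : T -> {poly F}) :
  (forall s, P s != 0) -> injective (fun s => size (P s)) ->
  (exists s, c s != 0) -> \sum_s c s *: P s != 0.
Proof.
move=> nzP injP [s0 cs0].
case: (arg_maxnP (P := fun s => c s != 0) (fun s => size (P s)) cs0) => s cs smax.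
apply/eqP => /(congr1 (fun p : {poly F} => p`_(size (P s)).-1)).
rewrite coef0 coef_sum (bigD1 s) //= coefZ big1 => [|s' ne].
  rewrite addr0 -lead_coefE => /eqP.
  by rewrite mulf_eq0 (negPf cs) lead_coef_eq0 (negPf (nzP s)).
rewrite coefZ; have [->|/smax /= le] := eqVneq (c s') 0; first by rewrite mul0r.
rewrite nth_default ?mulr0 // -ltnS prednK ?lt0n ?size_poly_eq0 //.
rewrite ltn_neqAle le andbT; apply: contra ne => /eqP e; apply/eqP; exact: injP.
Qed.

(** The matrix of coefficients has more rows than columns, hence a nonzero left kernel. *)
Lemma ex_poly_relation (F : fieldType) (T : finType) (N : nat) (P : T -> {poly F}) :
  (forall s, (size (P s) <= N)%N) -> (N < #|T|)%N ->
  exists2 c : T -> F, (exists s, c s != 0) & \sum_s c s *: P s = 0.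
Proof.
move=> szP ltN; pose M := \matrix_(i < #|T|, l < N) (P (enum_val i))`_l.
have : kermx M != 0.
  rewrite kermx_eq0 /row_free; apply: contraTneq ltN => <-.
  by rewrite -leqNgt rank_leq_col.
case/rowV0Pn => u /sub_kermxP uM0 nzu; exists (fun s => u ord0 (enum_rank s)).
  case/rV0Pn: nzu => i ui; exists (enum_val i); by rewrite enum_valK.
apply/polyP => l; rewrite coef0 coef_sum.
have [ltl|gel] := ltnP l N; last first.
  by rewrite big1 // => s _; rewrite coefZ nth_default ?mulr0 // (leq_trans (szP s)).
move/matrixP/(_ ord0 (Ordinal ltl)): uM0; rewrite !mxE => uM; apply: (etrans _ uM).
rewrite [RHS](reindex enum_rank) /=; last first.
  by exists enum_val => ? _; [exact: enum_rankK | exact: enum_valK].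
by apply: eq_bigr => s _; rewrite coefZ mxE enum_rankK.
Qed.

Section Stepanov.
Variables (L : finFieldType) (q k : nat) (b gam : L).
Hypotheses (pq : [pchar L].-nat q) (q_gt1 : (1 < q)%N) (k_gt0 : (0 < k)%N).
Hypothesis cardL : #|L| = (q ^ k.*2)%N.
Hypotheses (b_neq0 : b != 0) (bq : b ^+ q = b).

Let R := (q ^ k)%N.
Let r := (q ^ k.-1)%N.

Definition kloosterman_arg (b x : L) : L := x + b / x.

(* For [z ^+ (q ^ n) = z] this is the trace of [z] to the subfield with [q] elements. *)
Definition ptrace (n : nat) (z : L) : L := \sum_(i < n) z ^+ (q ^ i).

(* [x^r] clears the denominators of the half trace of [x + b / x]. *)
Let W : {poly L} :=
  \sum_(i < k) ('X^(r + q ^ i) + b%:P * 'X^(r - q ^ i)).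

Let r_gt0 : (0 < r)%N. Proof. by rewrite expn_gt0 ltnW. Qed.
Let RE : R = (q * r)%N. Proof. by rewrite /R /r -expnS prednK. Qed.

Lemma frobX n (x y : L) : (x + y) ^+ (q ^ n) = x ^+ (q ^ n) + y ^+ (q ^ n).
Proof. by apply: exprDn_pchar; rewrite pnatX pq. Qed.

Lemma frobX_sum n (I : Type) (s : seq I) (P : pred I) (E : I -> L) :
  (\sum_(i <- s | P i) E i) ^+ (q ^ n) = \sum_(i <- s | P i) E i ^+ (q ^ n).
Proof.
apply: (big_morph (fun x => x ^+ (q ^ n))); first exact: frobX.
by rewrite expr0n expn_eq0 gtn_eqF ?(ltnW q_gt1).
Qed.

Lemma frobX_fix n (x : L) : x ^+ q = x -> x ^+ (q ^ n) = x.
Proof. by move=> e; elim: n => [|n IH]; rewrite ?expr1 // expnSr exprM IH. Qed.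

Let size_W : size W = (2 * r).+1.
Proof.
have kE : k = k.-1.+1 by rewrite prednK.
(* The index [k.-1] contributes [X^(2 r) + b], the only part that reaches degree [2 r]. *)
rewrite /W kE big_ord_recr /= -/r subnn addnn -mul2n expr0 mulr1.
rewrite -(size_polyXn L (2 * r)) addrCA size_polyDl // size_polyXn ltnS.
have sz0 : (size (b%:P) <= 2 * r)%N.
  by rewrite size_polyC b_neq0; lia.
apply: (leq_trans (size_polyD _ _)); rewrite geq_max sz0 andbT.
apply: (leq_trans (size_sum _ _ _)); apply/bigmax_leqP => i _.
have lt : (q ^ i < r)%N by rewrite /r ltn_exp2l.
apply: (leq_trans (size_polyD _ _)); rewrite geq_max size_polyXn.
apply/andP; split; first lia.
rewrite mul_polyC; apply: (leq_trans (size_scale_leq _ _)); rewrite size_polyXn.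
by have := r_gt0; have := expn_gt0 q i; rewrite (ltnW q_gt1) /=; lia.
Qed.

Let W_neq0 : W != 0. Proof. by rewrite -size_poly_eq0 size_W. Qed.

Let w (x : L) := ptrace k (kloosterman_arg b x).

Let hornerW x : x != 0 -> W.[x] = x ^+ r * w x.
Proof.
move=> nzx; rewrite /W horner_sum /w /ptrace mulr_sumr; apply: eq_bigr => i _.
have lei : (q ^ i <= r)%N by rewrite leq_exp2l // -ltnS prednK.
rewrite /kloosterman_arg frobX exprMn exprVn (frobX_fix _ bq) mulrDr !hornerE exprD.
congr (_ + _); rewrite expfB_cond ?(negPf nzx) // mulrCA; exact: mulrA.
Qed.

(** The upper half of the terms of the full trace are the [R]-th powers of the lower half. *)
Let w_frob x : ptrace k.*2 (kloosterman_arg b x) = gam -> w x ^+ R = gam - w x.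
Proof.
rewrite /ptrace -addnn big_split_ord /= => <-; rewrite /w /ptrace [X in _ = X - _]addrC addrK.
rewrite frobX_sum; apply: eq_bigr => i _ /=.
by rewrite -exprM -expnD addnC.
Qed.

(* The auxiliary polynomial is a combination of the [P s], whose degrees are distinct. If the trace
   of [x + b / x] is [gam], then [x ^+ (R * R) = x] and [w x ^+ R = gam - w x] turn [(P s).[x] ^+ R]
   into a multiple of [(B s).[x]]; the [B s] have low degree, hence are linearly dependent. *)
Let T := ('I_r * 'I_r.+2 * 'I_q)%type.
Let e (s : T) := (s.1.1 + s.1.2 * R)%N.
Let P (s : T) : {poly L} := 'X^(e s) * (W ^+ s.2 * 'X^((q.-1 - s.2) * r)).
Let B (s : T) : {poly L} :=
  'X^(s.1.1 * R + s.1.2) * ((gam *: 'X^r - W) ^+ s.2 * 'X^((q.-1 - s.2) * r)).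

Let size_P s : size (P s) = (e s + (q.-1 + s.2) * r).+1.
Proof.
case: s => [[a i] j]; rewrite /P /=.
have szWj : size (W ^+ j) = (2 * r * j).+1.
  by rewrite -[LHS]prednK ?size_exp ?size_W // lt0n size_poly_eq0 expf_neq0.
rewrite size_mul ?size_mul ?mulf_neq0 ?expf_neq0 ?polyX_eq0 // szWj !size_polyXn /e /=.
by have := ltn_ord j; nia.
Qed.

Let size_B s : (size (B s) <= (r.-1 * R + r.+1 + 2 * r * q.-1).+1)%N.
Proof.
case: s => [[a i] j]; rewrite /B /=.
apply: (leq_trans (size_polyMleq _ _)); rewrite size_polyXn addSn /=.
apply: (@leq_trans (a * R + i + (2 * r * q.-1).+1)).
  rewrite leq_add2l; apply: (leq_trans (size_polyMleq _ _)).
  rewrite size_polyXn addnS /=.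
  apply: (@leq_trans ((2 * r * j).+1 + (q.-1 - j) * r)); last first.
    by have := ltn_ord j; nia.
  rewrite leq_add2r; apply: (leq_trans (size_poly_exp_leq _ _)).
  rewrite ltnS leq_mul2r; apply/orP; right.
  rewrite -subn1 leq_subLR addnC addn1.
  apply: (leq_trans (size_polyD _ _)); rewrite size_polyN size_W geq_max leqnn andbT.
  by apply: (leq_trans (size_scale_leq _ _)); rewrite size_polyXn; lia.
have : (a * R <= r.-1 * R)%N by rewrite leq_mul2r -ltnS prednK ?ltn_ord ?orbT.
by have := ltn_ord i; lia.
Qed.

(** Up to a constant the degree is [(i q + j) r + a] with [a < r] and [j < q], a mixed-radix
    expansion. *)
Let size_P_inj : injective (fun s => size (P s)).
Proof.
case=> [[a i] j] [[a' i'] j'] /=; rewrite !size_P /e /= RE.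
have lta := ltn_ord a; have lta' := ltn_ord a'.
have ltj := ltn_ord j; have ltj' := ltn_ord j'.
have eE (x y z : nat) : (x + y * (q * r) + (q.-1 + z) * r = (y * q + z) * r + x + q.-1 * r)%N.
  by lia.
rewrite !eE => /eqP; rewrite eqSS eqn_add2r => /eqP E.
have ea : val a = val a'.
  by move/(congr1 (modn^~ r)): E; rewrite !modnMDl !modn_small.
have /eqP : ((i * q + j) * r = (i' * q + j') * r)%N by move: E; rewrite /= in ea *; lia.
rewrite eqn_pmul2r // => /eqP E2.
have ej : val j = val j'.
  by move/(congr1 (modn^~ q)): E2; rewrite !modnMDl !modn_small.
have /eqP : (i * q = i' * q)%N by move: E2; rewrite /= in ej *; lia.
rewrite eqn_pmul2r ?(ltnW q_gt1) // => /eqP ei.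
by congr (_, _, _); apply: val_inj.
Qed.

Lemma card_trace_kloosterman_arg :
  (#|[set x : L | (x != 0%R) && (ptrace k.*2 (kloosterman_arg b x) == gam)]|
     <= r * R + 3 * R)%N.
Proof.
(* [T] has [(r + 2) R] elements, and the [B s] have size at most [(r + 1) R - r + 2]. The range
   [r.+2] of the second exponent is chosen for this inequality. *)
have [|c' nzc' eqc'] := ex_poly_relation size_B.
  rewrite !card_prod !card_ord RE; have := q_gt1; have := r_gt0; nia.
(* Since [R * R = #|L|], taking [R]-th powers is an involution of [L]: raising the combination of
   the [P s] to the power [R] brings back the coefficients [c']. *)
pose c s := c' s ^+ R.
have cR s : c s ^+ R = c' s.
  by rewrite /c -exprM -expnD addnn -cardL expf_card.
have nzPsi : \sum_s c s *: P s != 0.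
  apply: sum_scale_neq0 => // [s|]; first by rewrite -size_poly_eq0 size_P.
  by case: nzc' => s cs; exists s; rewrite expf_neq0.
rewrite cardE; apply: (@leq_trans (size (\sum_s c s *: P s)).-1).
  rewrite -ltnS prednK ?lt0n ?size_poly_eq0 //.
  apply: max_poly_roots => //; last exact: enum_uniq.
  apply/allP => x; rewrite mem_enum inE => /andP[nzx /eqP trx].
  (* The padding by ['X^((q.-1 - j) * r)] makes the power of [x] that clears denominators the same
     for every [j], so that it can be taken out of the whole sum. *)
  have clear_den (y : L) (j : 'I_q) :
      (x ^+ r * y) ^+ j * x ^+ ((q.-1 - j) * r) = x ^+ (q.-1 * r) * y ^+ j.
    rewrite exprMn -exprM mulrAC -exprD -mulnC -mulnDl subnKC //.
    by rewrite -ltnS prednK ?(ltnW q_gt1).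
  have WB : (gam *: 'X^r - W).[x] = x ^+ r * (gam - w x).
    by rewrite hornerD hornerN hornerZ hornerXn hornerW // mulrBr mulrC.
  have PR s : (P s).[x] ^+ R = x ^+ (q.-1 * r) ^+ R / x ^+ (q.-1 * r) * (B s).[x].
    case: s => [[a i] j]; rewrite /P /B !hornerM !horner_exp WB hornerW // !hornerX /=.
    rewrite !clear_den !exprMn -[RHS]mulrA.
    rewrite [(w x ^+ j) ^+ R]exprAC w_frob //.
    have -> : x ^+ e (a, i, j) ^+ R = x ^+ (a * R + i).
      rewrite /e /= -exprM.
      have -> : ((a + i * R) * R = a * R + #|L| * i)%N.
        by rewrite cardL -addnn expnD -/R; lia.
      by rewrite exprD [x ^+ (#|L| * i)]exprM expf_card -exprD.
    by rewrite [LHS]mulrCA; congr (_ * _); rewrite [RHS]mulrCA mulKf // expf_neq0.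
  have : (\sum_s c s *: P s).[x] ^+ R = 0.
    rewrite horner_sum frobX_sum.
    under eq_bigr => s _ do rewrite hornerZ exprMn cR PR mulrCA -hornerZ.
    by rewrite -mulr_sumr -horner_sum eqc' horner0 mulr0.
  by move/eqP; rewrite expf_eq0 => /andP[_].
(* The largest degree, at [a = r - 1], [i = r + 1], [j = q - 1], is [(r + 3) R - r - 1]. *)
rewrite -ltnS prednK ?lt0n ?size_poly_eq0 //.
apply: (leq_trans (size_sum _ _ _)); apply/bigmax_leqP => -[[a i] j] _.
apply: (leq_trans (size_scale_leq _ _)); rewrite size_P /e /= RE.
have := ltn_ord a; have := ltn_ord i; have := ltn_ord j; nia.
Qed.

End Stepanov.

(** * Finite extensions and Frobenius fixed points *)

Lemma pchar_nat_card (F : finFieldType) : [pchar F].-nat #|F|.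
Proof.
have [p _ pF] := finPcharP F; rewrite (eq_pnat _ (pcharf_eq pF)).
by rewrite (card_pprimeChar pF) pnatX pnat_id ?orbT // (pcharf_prime pF).
Qed.

Lemma finField_card_gt1 (F : finFieldType) : (1 < #|F|)%N.
Proof. exact: finNzRing_gt1. Qed.

(** This is the splitting field of [X^m - X]. The roots are distinct and form the subfield fixed by
    the [n]-th power of the Frobenius generator [a]; as that subfield contains all the roots, it is
    the whole field. *)
Lemma ex_finField_extension (F : finFieldType) (n : nat) : (0 < n)%N ->
  exists (L : finFieldType) (iota : {rmorphism F -> L}), #|L| = (#|F| ^ n)%N.
Proof.
move=> n_gt0; set q := #|F|; set m := (q ^ n)%N.
have q_gt1 : (1 < q)%N := finField_card_gt1 F.
have m_gt1 : (1 < m)%N by rewrite (ltn_exp2l 0).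
have m_gt0 := ltnW m_gt1; have m1_gt0 : (0 < m.-1)%N by rewrite -ltnS prednK.
pose p (K : nzRingType) : {poly K} := 'X^m - 'X.
have Dp (K : nzRingType) : p K = ('X^(m.-1) - 1) * ('X - 0).
  by rewrite /p subr0 mulrBl mul1r -exprSr prednK.
have /FinSplittingFieldFor[/= L splitLp] : p F != 0.
  by rewrite Dp monic_neq0 ?rpredM ?monicXsubC ?monicXnsubC.
rewrite rmorphB rmorphXn /= map_polyX -/(p L) in splitLp.
have [ch _ pcharF] := finPcharP F.
have pcharL : ch \in [pchar L] by rewrite pchar_lalg.
(* Hence [m - 1] equals [-1] in [L], which makes [X^(m-1) - 1] separable. *)
have qL : q%:R = 0 :> L.
  rewrite /q (card_pprimeChar pcharF).
  case: (logn _ _) (card_pprimeChar pcharF) => [e|e _]; last first.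
    by rewrite natrX pcharf0 // expr0n.
  by move: q_gt1; rewrite /q e.
pose Fm := FinFieldExtType L; exists Fm; exists (in_alg L).
have /finField_galois_generator[/= a _ Da] : (1 <= {:L})%VS by apply: sub1v.
pose Em := fixedSpace (a ^+ n)%g; rewrite /= dimv1 expn1 in Da.
have {splitLp} [zs DpL defL] := splitLp.
have Uzs : uniq zs.
  rewrite -separable_prod_XsubC -(eqp_separable DpL) Dp separable_root andbC.
  rewrite /root !hornerE subr_eq0 eq_sym expr0n gtn_eqF ?oner_eq0 //=.
  rewrite cyclotomic.separable_Xn_sub_1 // -subn1 natrB // subr_eq0.
  by rewrite natrX qL expr0n gtn_eqF // eq_sym oner_eq0.
suffices /eq_card-> : Fm =i zs.
  apply: succn_inj; rewrite (card_uniqP _) //= -(size_prod_XsubC _ id).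
  by rewrite -(eqp_size DpL) size_polyDl size_polyXn // size_polyN size_polyX.
have in_zs : zs =i Em.
  move=> z; rewrite -root_prod_XsubC -(eqp_root DpL) (sameP fixedSpaceP eqP).
  rewrite /root !hornerE subr_eq0 /= /m; congr (_ == z).
  elim: (n) => [|i IHi]; first by rewrite gal_id.
  by rewrite expgSr expnSr exprM IHi galM ?Da ?memvf.
suffices defEm : Em = {:L}%VS by move=> z; rewrite in_zs defEm memvf.
apply/eqP; rewrite eqEsubv subvf -defL -[Em]subfield_closed agenvS //.
by rewrite subv_add sub1v; apply/span_subvP=> z; rewrite in_zs.
Qed.

Section FixedPoints.
Variables (L : finFieldType) (q : nat).
Hypotheses (pq : [pchar L].-nat q) (q_gt1 : (1 < q)%N).

(** Inside a suitable [L] this is the subfield with [q ^ n] elements. Keeping all levels of the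
    tower as subsets of one field avoids embeddings between them. *)
Definition frob_fix (n : nat) : {set L} := [set z : L | z ^+ (q ^ n) == z].

Lemma frob_fixP n z : reflect (z ^+ (q ^ n) = z) (z \in frob_fix n).
Proof. by rewrite inE; apply: eqP. Qed.

Lemma frob_fix0 n : 0 \in frob_fix n.
Proof. by rewrite inE expr0n expn_eq0 gtn_eqF ?(ltnW q_gt1). Qed.

Lemma frob_fix1 n : 1 \in frob_fix n.
Proof. by rewrite inE expr1n. Qed.

Lemma frob_fixD n : {in frob_fix n &, forall x y, x + y \in frob_fix n}.
Proof. by move=> x y; rewrite !inE frobX // => /eqP-> /eqP->. Qed.

Lemma frob_fixM n : {in frob_fix n &, forall x y, x * y \in frob_fix n}.
Proof. by move=> x y; rewrite !inE exprMn => /eqP-> /eqP->. Qed.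

Lemma frob_fixV n : {in frob_fix n, forall x, x^-1 \in frob_fix n}.
Proof. by move=> x; rewrite !inE exprVn => /eqP->. Qed.

Lemma frobXN n (x : L) : (- x) ^+ (q ^ n) = - x ^+ (q ^ n).
Proof.
apply/eqP; rewrite -addr_eq0 -frobX // addNr expr0n expn_eq0.
by rewrite gtn_eqF ?(ltnW q_gt1).
Qed.

Lemma frob_fixN n : {in frob_fix n, forall x, - x \in frob_fix n}.
Proof. by move=> x; rewrite !inE frobXN => /eqP->. Qed.

Lemma frob_fixB n : {in frob_fix n &, forall x y, x - y \in frob_fix n}.
Proof. by move=> x y hx hy; rewrite frob_fixD ?frob_fixN. Qed.

Lemma frob_fix_mul n k : {subset frob_fix n <= frob_fix (n * k)}.
Proof.
move=> z /frob_fixP hz; apply/frob_fixP; elim: k => [|k IH]; first by rewrite muln0 expr1.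
by rewrite mulnS expnD exprM hz.
Qed.

Lemma size_frob_poly n : (0 < n)%N -> size ('X^(q ^ n) - 'X : {poly L}) = (q ^ n).+1.
Proof.
move=> n_gt0; rewrite size_polyDl size_polyXn // size_polyN size_polyX ltnS.
by rewrite (ltn_exp2l 0).
Qed.

Lemma frob_poly_dvd n :
  ('X^(q ^ n) - 'X : {poly L}) %| 'X^(q ^ (n * 2)) - 'X.
Proof.
set A := 'X^(q ^ n) - 'X : {poly L}.
have AX : 'X^(q ^ (n * 2)) = A ^+ (q ^ n) + 'X^(q ^ n) :> {poly L}.
  rewrite -exprDn_pchar ?subrK; last by rewrite (eq_pnat _ (pchar_poly _)) pnatX pq.
  by rewrite -exprM -expnD addnn muln2.
by rewrite AX -addrA dvdp_add // dvdp_exp ?expn_gt0 ?(ltnW q_gt1).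
Qed.

(** Repeated doubling of the exponent shows that [X^(q^(2^j)) - X] divides [X^#|L| - X], a product
    of distinct linear factors; so it has as many roots in [L] as its degree. *)
Lemma card_frob_fix j m : #|L| = (q ^ 2 ^ m)%N -> (j <= m)%N ->
  #|frob_fix (2 ^ j)| = (q ^ 2 ^ j)%N.
Proof.
move=> cardL lejm.
have dvd : ('X^(q ^ 2 ^ j) - 'X : {poly L}) %| \prod_(x : L) ('X - x%:P).
  rewrite -finField_genPoly cardL -(subnKC lejm).
  elim: (m - j)%N => [|i IH]; first by rewrite addn0.
  by rewrite addnS expnSr (dvdp_trans IH) // frob_poly_dvd.
have n_gt0 : (0 < 2 ^ j)%N by rewrite expn_gt0.
rewrite -big_enum /= in dvd; have [ms eqp] := dvdp_prod_XsubC dvd.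
have szm : size (mask ms (enum L)) = (q ^ 2 ^ j)%N.
  by apply: succn_inj; rewrite -(size_prod_XsubC _ id) -(eqp_size eqp) size_frob_poly.
rewrite -szm -(card_uniqP (mask_uniq (enum_uniq L) ms)); apply: eq_card => z.
by rewrite -root_prod_XsubC -(eqp_root eqp) inE /root !hornerE subr_eq0.
Qed.

Lemma ptrace_fix n (z : L) : z \in frob_fix n -> ptrace q n z \in frob_fix 1.
Proof.
case: n => [|n] /frob_fixP hz; first by rewrite /ptrace big_ord0 frob_fix0.
apply/frob_fixP; rewrite /ptrace (frobX_sum pq q_gt1) big_ord_recr [RHS]big_ord_recl /=.
rewrite addrC; congr (_ + _); first by rewrite -exprM -expnD addn1 hz expr1.
by apply: eq_bigr => i _; rewrite -exprM -expnD addn1.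
Qed.

Lemma ptraceD n (x y : L) : ptrace q n (x + y) = ptrace q n x + ptrace q n y.
Proof. by rewrite /ptrace -big_split; apply: eq_bigr => i _; rewrite frobX. Qed.

Lemma ptraceN n (x : L) : ptrace q n (- x) = - ptrace q n x.
Proof. by rewrite /ptrace -sumrN; apply: eq_bigr => i _; rewrite frobXN. Qed.

Lemma ptrace_double n (z : L) : ptrace q (n * 2) z = ptrace q n (z + z ^+ (q ^ n)).
Proof.
rewrite ptraceD muln2 -addnn /ptrace big_split_ord /=; congr (_ + _).
by apply: eq_bigr => i _; rewrite -exprM -expnD.
Qed.

End FixedPoints.

(** * Kloosterman sums along a quadratic tower *)

(** Translation by [a] multiplies the sum by [f a]. Multiplicativity is asked on [A] only, because
    the characters of the tower are meaningful on subfields only. *)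
Lemma sum_character_eq0 (V : finZmodType) (C : idomainType) (A : {set V}) (f : V -> C) a :
  {in A &, forall x y, x - y \in A} -> {in A &, forall x y, f (x + y) = f x * f y} ->
  a \in A -> f a != 1 -> \sum_(x in A) f x = 0.
Proof.
move=> AB fD aA fa1; set S := \sum_(x in A) f x.
have A0 : 0 \in A by rewrite -(subrr a) AB.
have AN x : x \in A -> - x \in A by move=> xA; rewrite -sub0r AB.
have AD x y : x \in A -> y \in A -> x + y \in A.
  by move=> xA yA; rewrite -[y]opprK AB ?AN.
have : S = f a * S.
  rewrite {1}/S (reindex_inj (addrI a)) /= mulr_sumr; apply: eq_big => [x | x xA].
    by apply/idP/idP => [h|]; [rewrite -(addKr a x) AD ?AN | exact: AD].
  by rewrite fD // -(addKr a x) AD ?AN.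
move/eqP; rewrite -subr_eq0 -[X in X - _]mul1r -mulrBl mulf_eq0 subr_eq0 eq_sym.
by rewrite (negPf fa1) => /eqP.
Qed.

(** * Monic quadratics over a finite field and their roots in its quadratic extension *)

Section QuadraticFibres.
Variables (L : finFieldType) (q : nat).
Hypotheses (pq : [pchar L].-nat q) (q_gt1 : (1 < q)%N).
Variable n : nat.
Hypotheses (cardE : #|frob_fix L q n| = (q ^ n)%N)
           (cardE2 : #|frob_fix L q (n * 2)| = (q ^ (n * 2))%N).
Let E := frob_fix L q n.
Let E2 := frob_fix L q (n * 2).
Let N := (q ^ n)%N.

(** Roots in [E] of [X^2 - s X + p]; [U2] collects the elements of [E2] with relative trace [s] and
    relative norm [p]. *)
Let U1 (s p : L) := [set x in E | x * (s - x) == p].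
Let U2 (s p : L) := [set z in E2 | (z + z ^+ N == s) && (z * z ^+ N == p)].

Lemma card_quadratic_roots (s p : L) : (#|[set x : L | (x * (s - x) == p)%R]| <= 2)%N.
Proof.
case: (pickP [pred x : L | x * (s - x) == p]) => [x /= /eqP xP|no]; last first.
  by rewrite eq_card0 // => x; rewrite inE; exact: no.
apply: (@leq_trans #|[set x; (s - x)%R]|); last by rewrite cards2; case: (_ != _).
apply/subset_leq_card/subsetP => y; rewrite !inE -xP => /eqP eq.
have : (y - x) * (y - (s - x)) = 0.
  have -> : (y - x) * (y - (s - x)) = x * (s - x) - y * (s - y).
    by rewrite !mulrBr !mulrBl; ring.
  by rewrite eq subrr.
by move/eqP; rewrite mulf_eq0 !subr_eq0.
Qed.

(** Both sets consist of roots of one quadratic. A common element is fixed by Frobenius, hence a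
    double root, and then each set has at most one element. *)
Lemma card_fibres_le2 s p : s \in E -> p \in E -> (#|U1 s p| + #|U2 s p| <= 2)%N.
Proof.
move=> sE pE; set rho := [set x : L | x * (s - x) == p].
have sub1 : U1 s p \subset rho by apply/subsetP => x; rewrite !inE => /andP[_].
have sub2 : U2 s p \subset rho.
  apply/subsetP => z; rewrite !inE => /andP[_ /andP[/eqP <- /eqP <-]].
  by rewrite [X in X - z]addrC addrK.
have [disj|] := boolP [disjoint U1 s p & U2 s p].
  apply: leq_trans (card_quadratic_roots s p).
  by rewrite -cardsUI (disjoint_setI0 disj) cards0 addn0 subset_leq_card // subUset sub1.
rewrite -setI_eq0 => /set0Pn[z]; rewrite !inE => /andP[/andP[/eqP zN /eqP zp] /andP[_ /andP[/eqP zs _]]].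
have rho1 : rho \subset [set z].
  apply/subsetP => x; rewrite !inE -zp -zs zN => /eqP e.
  rewrite -subr_eq0 -sqrf_eq0; apply/eqP.
  have -> : (x - z) ^+ 2 = z * (z + z - z) - x * (z + z - x) by ring.
  by rewrite e subrr.
by rewrite (@leq_add _ _ 1 1) // -(cards1 z) subset_leq_card // (subset_trans _ rho1).
Qed.

Let EE2 x : x \in E2 -> x ^+ N ^+ N = x.
Proof. by move/frob_fixP; rewrite muln2 -addnn expnD exprM. Qed.

Let sum_U1 (C : nmodType) (f : L -> L -> C) :
  \sum_(x in E) \sum_(y in E) f (x + y) (x * y) =
  \sum_(s in E) \sum_(p in E) f s p *+ #|U1 s p|.
Proof.
transitivity (\sum_(x in E) \sum_(s in E) f s (x * (s - x))).
  apply: eq_bigr => x xE; rewrite (reindex_inj (addIr (- x))) /=.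
  apply: eq_big => [y | y _]; last by rewrite addrC subrK.
  by apply/idP/idP => h; [rewrite -(subrK x y) frob_fixD | rewrite frob_fixB].
rewrite exchange_big; apply: eq_bigr => s sE.
rewrite (partition_big (fun x => x * (s - x)) (mem E)) /=; last first.
  by move=> x xE; rewrite frob_fixM ?frob_fixB.
apply: eq_bigr => p pE; rewrite -sumr_const.
apply: eq_big => [x | x]; [by rewrite /U1 [RHS]in_set | by case/andP=> _ /eqP->].
Qed.

Let sum_U2 (C : nmodType) (f : L -> L -> C) :
  \sum_(z in E2) f (z + z ^+ N) (z * z ^+ N) =
  \sum_(s in E) \sum_(p in E) f s p *+ #|U2 s p|.
Proof.
rewrite (partition_big (fun z => z + z ^+ N) (mem E)) /=; last first.
  by move=> z zE; apply/frob_fixP; rewrite frobX // EE2 // addrC.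
apply: eq_bigr => s sE.
rewrite (partition_big (fun z => z * z ^+ N) (mem E)) /=; last first.
  by move=> z /andP[zE _]; apply/frob_fixP; rewrite exprMn EE2 // mulrC.
apply: eq_bigr => p pE; rewrite -sumr_const.
apply: eq_big => [z | z]; first by rewrite /U2 [RHS]in_set andbA.
by case/andP=> /andP[_ /eqP->] /eqP->.
Qed.

(* A monic quadratic over [E] has both roots in [E], or both in [E2] and exchanged by Frobenius.
   That the second case occurs whenever the first fails follows by counting. *)
Let card_fibres s p : s \in E -> p \in E -> (#|U1 s p| + #|U2 s p|)%N = 2%N.
Proof.
pose c s' p' : int := 2%:R - (#|U1 s' p'| + #|U2 s' p'|)%:R.
have c_ge0 s' p' : s' \in E -> p' \in E -> 0 <= c s' p'.
  by move=> sE pE; rewrite subr_ge0 ler_nat card_fibres_le2.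
(* The fibres exhaust [E x E] and [E2], each of size [q^(2n)], so the nonnegative defects add up to
   zero. *)
have tot : \sum_(s' in E) \sum_(p' in E) c s' p' = 0.
  have e1 := sum_U1 (fun _ _ => 1 : int); have e2 := sum_U2 (fun _ _ => 1 : int).
  rewrite !sumr_const cardE in e1; rewrite sumr_const cardE2 in e2.
  under eq_bigr => s' _ do under eq_bigr => p' _ do rewrite /c natrD opprD addrA.
  under eq_bigr => s' _ do rewrite !big_split /= !sumrN !sumr_const cardE.
  rewrite !big_split /= !sumrN -e1 -e2 sumr_const cardE.
  by rewrite addrK -mulrnA muln2 -addnn expnD subrr.
move=> sE pE.
have row_ge0 s' : s' \in E -> 0 <= \sum_(p' in E) c s' p'.
  by move=> s'E; apply: sumr_ge0 => p' p'E; exact: c_ge0.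
have tot_s := psumr_eq0P row_ge0 tot sE.
have : c s p = 0 := psumr_eq0P (fun p' => c_ge0 s p' sE) tot_s pE.
by rewrite /c; lia.
Qed.

Lemma sum_quadratic_fibres (C : nmodType) (f : L -> L -> C) :
  \sum_(x in E) \sum_(y in E) f (x + y) (x * y) +
  \sum_(z in E2) f (z + z ^+ N) (z * z ^+ N) =
  (\sum_(s in E) \sum_(p in E) f s p) *+ 2.
Proof.
rewrite sum_U1 sum_U2 -big_split -sumrMnl; apply: eq_bigr => s sE /=.
rewrite -big_split -sumrMnl; apply: eq_bigr => p pE /=.
by rewrite -mulrnDr card_fibres.
Qed.

End QuadraticFibres.

Section Tower.
Variables (L : finFieldType) (q m : nat) (C : numClosedFieldType) (psi : L -> C) (b u : L).
Hypotheses (pq : [pchar L].-nat q) (q_gt1 : (1 < q)%N) (two_neq0 : 2%:R != 0 :> L).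
Hypothesis cardL : #|L| = (q ^ 2 ^ m)%N.
Hypothesis psiD : {in frob_fix L q 1 &, forall x y, psi (x + y) = psi x * psi y}.
Hypothesis psi0 : psi 0 = 1.
Hypothesis psiN : {in frob_fix L q 1, forall x, psi (- x) = (psi x)^*}.
Hypotheses (uF : u \in frob_fix L q 1) (psiu : psi u != 1).
Hypotheses (bF : b \in frob_fix L q 1) (b_neq0 : b != 0).

Local Notation E j := (frob_fix L q (2 ^ j)).

Let chi j z := psi (ptrace q (2 ^ j) z).

Definition tower_kloosterman j : C :=
  \sum_(z in E j | z != 0) chi j (kloosterman_arg b z).

Let chiD j : {in E j &, forall x y, chi j (x + y) = chi j x * chi j y}.
Proof. by move=> x y xE yE; rewrite /chi ptraceD // psiD ?ptrace_fix. Qed.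

Let frob_fix_step j : {subset E j <= E j.+1}.
Proof. by rewrite expnSr; apply: frob_fix_mul. Qed.

Let frob_fix1_sub j : {subset frob_fix L q 1 <= E j}.
Proof. by move=> x /(frob_fix_mul (2 ^ j)); rewrite mul1n. Qed.

Let chi_step j z : chi j.+1 z = chi j (z + z ^+ (q ^ 2 ^ j)).
Proof. by rewrite /chi expnSr ptrace_double. Qed.

Let two_fix n : 2%:R \in frob_fix L q n.
Proof. by rewrite -[2%:R]/(1 + 1) frob_fixD ?frob_fix1. Qed.

Let chi0 j : chi j 0 = 1.
Proof.
rewrite /chi /ptrace big1 // => i _.
by rewrite expr0n expn_eq0 gtn_eqF ?(ltnW q_gt1).
Qed.

(* Since [s / 2] has trace [s], halving keeps the character nontrivial along the tower. *)
Let chi_nontrivial j : exists2 v, v \in E j & chi j v != 1.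
Proof.
elim: j => [|j [v vE chiv]].
  by exists u => //; rewrite /chi /ptrace big_ord1 expr1.
have v2E : v / 2%:R \in E j by rewrite frob_fixM ?frob_fixV.
exists (v / 2%:R); first exact: frob_fix_step.
have vv : v / 2%:R + v / 2%:R = v by rewrite -mulrDl -mulr2n -[v *+ 2]mulr_natr mulfK.
by rewrite chi_step (frob_fixP _ _ _ v2E) vv.
Qed.

Let cardE j : (j <= m)%N -> #|E j| = (q ^ 2 ^ j)%N.
Proof. exact: card_frob_fix. Qed.

Let sum_chi j c : c \in E j ->
  \sum_(s in E j) chi j (c * s) = if c == 0 then #|E j|%:R else 0.
Proof.
move=> cE; have [->|nzc] := eqVneq.
  by rewrite (eq_bigr (fun=> 1)) ?sumr_const // => s _; rewrite mul0r chi0.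
have [v vE nv] := chi_nontrivial j.
apply: (@sum_character_eq0 _ _ _ _ (v / c)); rewrite ?frob_fixM ?frob_fixV //.
- exact: frob_fixB.
- by move=> x y xE yE; rewrite mulrDr chiD ?frob_fixM.
- by rewrite mulrC divfK.
Qed.

Let tower_kloostermanE j :
  tower_kloosterman j = \sum_(z in E j) if z == 0 then 0 else chi j (z + b / z).
Proof.
by rewrite /tower_kloosterman big_mkcondr; apply: eq_bigr => z _; case: eqP.
Qed.

(** At [s = x + y], [p = x y] the argument [s (1 + b / p)] becomes [(x + b/x) + (y + b/y)]. Pairs in
    the field thus give [K_j^2] and conjugate pairs give [K_(j+1)]; over all [(s, p)] the sum over
    [s] vanishes unless [p = - b]. *)
Lemma tower_kloosterman_double j : (j < m)%N ->
  tower_kloosterman j.+1 = (q ^ 2 ^ j)%:R *+ 2 - tower_kloosterman j ^+ 2.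
Proof.
move=> ltjm; set N := (q ^ 2 ^ j)%N.
(* A zero product means a zero root; the value 0 drops the terms that the Kloosterman sums
   exclude. *)
pose f s p := if p == 0 then 0 else chi j (s * (1 + b / p)).
have cE2 : #|frob_fix L q (2 ^ j * 2)| = (q ^ (2 ^ j * 2))%N by rewrite -expnSr cardE.
have bE : b \in E j := frob_fix1_sub j bF.
have arg_prod (x y : L) : x != 0 -> y != 0 ->
    (x + y) * (1 + b / (x * y)) = (x + b / x) + (y + b / y).
  by move=> nzx nzy; field; rewrite nzx nzy.
have argE (x : L) : x \in E j -> x + b / x \in E j.
  by move=> xE; rewrite frob_fixD ?frob_fixM ?frob_fixV.
have := sum_quadratic_fibres pq q_gt1 (cardE (ltnW ltjm)) cE2 f.
have -> : \sum_(x in E j) \sum_(y in E j) f (x + y) (x * y) = tower_kloosterman j ^+ 2.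
  rewrite expr2 tower_kloostermanE mulr_suml; apply: eq_bigr => x xE.
  rewrite mulr_sumr; apply: eq_bigr => y yE; rewrite /f mulf_eq0.
  have [->|nzx] /= := eqVneq x 0; first by rewrite mul0r.
  have [_|nzy] /= := eqVneq y 0; first by rewrite mulr0.
  by rewrite arg_prod // chiD ?argE.
have -> : \sum_(z in frob_fix L q (2 ^ j * 2)) f (z + z ^+ (q ^ 2 ^ j)) (z * z ^+ (q ^ 2 ^ j)) =
    tower_kloosterman j.+1.
  rewrite -expnSr tower_kloostermanE; apply: eq_bigr => z zE; rewrite /f mulf_eq0.
  rewrite expf_eq0 expn_gt0 (ltnW q_gt1) /= orbb.
  have [_|nzz] /= := eqVneq z 0; first by [].
  rewrite arg_prod ?expf_neq0 // chi_step frobX //; congr (chi j (_ + _)).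
  by rewrite exprMn exprVn (frob_fixP _ _ _ bE).
have -> : \sum_(s in E j) \sum_(p in E j) f s p = (q ^ 2 ^ j)%:R.
  rewrite exchange_big (bigD1 (- b)) ?frob_fixN //= [X in _ + X]big1 => [|p /andP[pE nep]].
    rewrite addr0 /f oppr_eq0 (negPf b_neq0) invrN mulrN divff // subrr.
    by rewrite (eq_bigr (fun=> 1)) ?sumr_const ?cardE ?(ltnW ltjm) // => s _; rewrite mulr0 chi0.
  rewrite /f; have [_|nzp] := eqVneq p 0; first by rewrite big1.
  under eq_bigr do rewrite mulrC.
  rewrite sum_chi ?frob_fixD ?frob_fix1 ?frob_fixM ?frob_fixV // ifN //.
  apply: contra nep => /eqP/(congr1 ( *%R^~ p)); rewrite mul0r mulrDl mul1r divfK //.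
  by move/eqP; rewrite addr_eq0.
by move=> <-; rewrite addrC addKr.
Qed.

(** Replacing [z] by [- z] conjugates every term. *)
Lemma tower_kloosterman_real j : tower_kloosterman j \is Num.real.
Proof.
rewrite CrealE tower_kloostermanE rmorph_sum; apply/eqP.
rewrite (reindex_inj oppr_inj); apply: eq_big => [z | z zE].
  by apply/idP/idP => h; first rewrite -[z]opprK; rewrite frob_fixN.
rewrite oppr_eq0; have [_|nzz] := eqVneq z 0; first by rewrite rmorph0.
have -> : - z + b / - z = - (z + b / z) by rewrite invrN mulrN opprD.
have {}zE : z \in E j by rewrite -[z]opprK frob_fixN.
have bE := frob_fix1_sub j bF.
have argE : z + b / z \in E j by rewrite frob_fixD ?frob_fixM ?frob_fixV.
rewrite /chi ptraceN // psiN ?ptrace_fix //. exact: conjCK.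
Qed.

End Tower.

(** * The Weil bound for Kloosterman sums *)

(** Each count [N g] is at most [M = r R + 3 R]. As [psi] sums to zero, [N g] may be replaced by
    [N g - M], and the nonnegative [M - N g] add up to [q M - (R^2 - 1) = 3 q R + 1]. *)
Lemma tower_kloosterman_le (L : finFieldType) (q m : nat) (C : numClosedFieldType)
    (psi : L -> C) (b u : L) :
  [pchar L].-nat q -> (1 < q)%N -> #|L| = (q ^ 2 ^ m.+1)%N ->
  {in frob_fix L q 1 &, forall x y, psi (x + y) = psi x * psi y} -> psi 0 = 1 ->
  {in frob_fix L q 1, forall x, psi (- x) = (psi x)^*} ->
  u \in frob_fix L q 1 -> psi u != 1 -> b \in frob_fix L q 1 -> b != 0 ->
  `|tower_kloosterman q psi b m.+1| <= (4 * q * q ^ 2 ^ m)%:R.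
Proof.
move=> pq q_gt1 cardL psiD psi0 psiN uF psiu bF b_neq0.
set k := (2 ^ m)%N; set R := (q ^ k)%N; set r := (q ^ k.-1)%N.
have k_gt0 : (0 < k)%N by rewrite expn_gt0.
have R_gt0 : (0 < R)%N by rewrite expn_gt0 (ltnW q_gt1).
have RE : R = (q * r)%N by rewrite /R /r -expnS prednK.
have kE : (2 ^ m.+1 = k.*2)%N by rewrite expnS mul2n.
have bq : b ^+ q = b by move/frob_fixP: bF; rewrite expn1.
have cardL2 : #|L| = (q ^ k.*2)%N by rewrite cardL kE.
pose N g := #|[set x : L | (x != 0) && (ptrace q k.*2 (kloosterman_arg b x) == g)]|.
pose M := (r * R + 3 * R)%N.
have leNM g : (N g <= M)%N by apply: card_trace_kloosterman_arg.
have full z : z \in frob_fix L q (2 ^ m.+1) by apply/frob_fixP; rewrite -cardL expf_card.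
have trF z : ptrace q k.*2 z \in frob_fix L q 1 by rewrite -kE ptrace_fix.
have split_sum (f : L -> C) : \sum_(z | z != 0) f (ptrace q k.*2 (kloosterman_arg b z)) =
    \sum_(g in frob_fix L q 1) f g *+ N g.
  rewrite (partition_big (fun z => ptrace q k.*2 (kloosterman_arg b z)) (mem (frob_fix L q 1))) //=.
  apply: eq_bigr => g _; rewrite -sumr_const.
  by apply: eq_big => [z | z /andP[_ /eqP->] //]; rewrite inE.
have kloE : tower_kloosterman q psi b m.+1 = \sum_(g in frob_fix L q 1) psi g *+ N g.
  rewrite -split_sum /tower_kloosterman kE; apply: eq_bigl => z.
  by rewrite -kE full.
have sum_psi : \sum_(g in frob_fix L q 1) psi g = 0.
  by apply: (sum_character_eq0 _ psiD uF psiu); exact: frob_fixB.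
have normpsi g : g \in frob_fix L q 1 -> `|psi g| = 1.
  move=> gF; apply/eqP; rewrite -(@eqrXn2 _ 2) ?normr_ge0 // expr1n normCK -psiN //.
  by rewrite -psiD ?frob_fixN // subrr psi0.
have card1 : #|frob_fix L q 1| = q.
  have := @card_frob_fix L q pq q_gt1 0 m.+1 cardL (leq0n _).
  by rewrite !expn0 expn1.
have sumN : (\sum_(g in frob_fix L q 1) N g = (R * R).-1)%N.
  have := split_sum (fun=> 1); rewrite sumr_const.
  rewrite -natr_sum => /eqP; rewrite eqr_nat => /eqP <-.
  by rewrite cardC1 cardL2 -addnn expnD.
have -> : tower_kloosterman q psi b m.+1 =
    - \sum_(g in frob_fix L q 1) psi g *+ (M - N g).
  rewrite kloE; apply/eqP; rewrite -addr_eq0 -big_split /=.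
  under eq_bigr => g _ do rewrite -mulrnDr subnKC //.
  by rewrite sumrMnl sum_psi mul0rn.
rewrite normrN; apply: (le_trans (ler_norm_sum _ _ _)).
under eq_bigr => g gF do rewrite normrMn normpsi //.
rewrite -natr_sum ler_nat sumnB // sumN sum_nat_const card1.
rewrite /M RE; nia.
Qed.

(* With [y^2 = (4 + e) D] one step gives [(2 D - y^2)^2 = (2 + e)^2 D^2 >= (4 + 4 e) D^2]. *)
Lemma doubling_growth (F : realFieldType) (q m : nat) (y : nat -> F) (delta : F) :
  (0 < q)%N -> (forall j, (j < m)%N -> y j.+1 = (q ^ 2 ^ j)%:R *+ 2 - y j ^+ 2) ->
  0 <= delta -> (4 + delta) * q%:R <= y 0 ^+ 2 ->
  forall j, (j <= m)%N -> (4 + 4 ^+ j * delta) * (q ^ 2 ^ j)%:R <= y j ^+ 2.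
Proof.
move=> q_gt0 yS delta_ge0 y0; elim=> [|j IH] ltjm; first by rewrite expr0 mul1r.
have {}IH := IH (ltnW ltjm); rewrite yS // expnSr expnM natrX exprS.
have D_gt0 : 0 < (q ^ 2 ^ j)%:R :> F by rewrite ltr0n expn_gt0 q_gt0.
have e_ge0 : 0 <= 4 ^+ j * delta by rewrite mulr_ge0 ?exprn_ge0.
rewrite -[4 * _ * delta]mulrA.
move: (4 ^+ j * delta) ((q ^ 2 ^ j)%:R) D_gt0 e_ge0 IH => e D D_gt0 e_ge0 IH.
have le : (2 + e) * D <= y j ^+ 2 - D *+ 2 by rewrite mulr2n; lra.
have ge0 : 0 <= (2 + e) * D by rewrite mulr_ge0 ?(ltW D_gt0) //; lra.
rewrite -[leRHS]sqrrN opprB; apply: le_trans (_ : ((2 + e) * D) ^+ 2 <= _); last first.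
  by rewrite ler_sqr ?nnegrE // (le_trans ge0 le).
by rewrite exprMn ler_wpM2r ?sqr_ge0 // sqrrD; nra.
Qed.

Definition is_character (V : zmodType) (C : numClosedFieldType) (psi : V -> C) :=
  [/\ psi 0 = 1, {morph psi : x y / x + y >-> x * y},
      forall x, psi (- x) = (psi x)^* & exists x, psi x != 1].

Lemma odd_two_neq0 (K : finFieldType) : odd #|K| -> 2%:R != 0 :> K.
Proof.
move=> oddK; apply/negP => two0.
have c2 : 2%N \in [pchar K] by rewrite inE.
have := finField_card_gt1 K; move: oddK; rewrite (card_pprimeChar c2).
by case: (logn _ _) => // n; rewrite expnS oddM.
Qed.

Lemma kloosterman_sqr_le (R : realType) (K : finFieldType) (psi : K -> R[i]) (b : K) :
  odd #|K| -> is_character psi -> b != 0 ->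
  `|\sum_(x | x != 0) psi (x + b / x)| ^+ 2 <= (4 * #|K|)%:R.
Proof.
move=> oddK [psi0 psiD psiN [u psiu]] b_neq0; set q := #|K|.
have q_gt1 : (1 < q)%N := finField_card_gt1 K.
set S := \sum_(x | _) _.
have natC n : (n%:R : R)%:C%C = n%:R by rewrite rmorph_nat.
have doubleC (x y : R) : (x *+ 2 - y ^+ 2)%:C%C = x%:C%C *+ 2 - y%:C%C ^+ 2.
  by rewrite raddfB /= raddfMn rmorphXn.
(* The ambient field depends on [m], so each [m] has its own sequence; what they share is the
   initial value [S]. *)
have tower m : exists y : nat -> R,
  [/\ (y 0)%:C%C = S, forall j, (j < m.+1)%N -> y j.+1 = (q ^ 2 ^ j)%:R *+ 2 - y j ^+ 2
    & `|y m.+1| <= (4 * q * q ^ 2 ^ m)%:R].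
  have n_gt0 : (0 < 2 ^ m.+1)%N by rewrite expn_gt0.
  have [L [iota cardL]] := ex_finField_extension K n_gt0.
  (* A left inverse of [iota], with default value 0 off the image; the tower evaluates [psiL] on the
     image only. *)
  pose proj z : K := odflt 0 [pick x | iota x == z].
  have iotaK : cancel iota proj.
    move=> x; rewrite /proj; case: pickP => [y /eqP /fmorph_inj //|/(_ x)].
    by rewrite eqxx.
  pose psiL z := psi (proj z).
  have pq : [pchar L].-nat q.
    by rewrite (eq_pnat _ (fmorph_pchar iota)) pchar_nat_card.
  have iotaF x : iota x \in frob_fix L q 1.
    by apply/frob_fixP; rewrite expn1 -rmorphXn /= expf_card.
  have imF : frob_fix L q 1 = [set iota x | x in [set: K]].
    apply/eqP; rewrite eq_sym eqEcard; apply/andP; split.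
      by apply/subsetP => _ /imsetP[x _ ->].
    rewrite card_imset; last exact: fmorph_inj.
    rewrite cardsT -/q; have := @card_frob_fix L q pq q_gt1 0 m.+1 cardL (leq0n _).
    by rewrite !expn0 expn1 => ->.
  have frobF z : z \in frob_fix L q 1 -> exists x, z = iota x.
    by rewrite imF => /imsetP[x _ ->]; exists x.
  have psiLD : {in frob_fix L q 1 &, forall x y, psiL (x + y) = psiL x * psiL y}.
    by move=> _ _ /frobF[x ->] /frobF[y ->]; rewrite /psiL -rmorphD !iotaK psiD.
  have psiLN : {in frob_fix L q 1, forall x, psiL (- x) = (psiL x)^*}.
    by move=> _ /frobF[x ->]; rewrite /psiL -rmorphN !iotaK psiN.
  have psiL0 : psiL 0 = 1 by rewrite /psiL -(rmorph0 iota) iotaK.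
  have nu : psiL (iota u) != 1 by rewrite /psiL iotaK.
  have nb : iota b != 0 by rewrite fmorph_eq0.
  have two_neq0 : 2%:R != 0 :> L.
    by rewrite -(rmorph_nat iota) fmorph_eq0 odd_two_neq0.
  pose Y := tower_kloosterman q psiL (iota b).
  have Yreal j : Y j \is Num.real by apply: tower_kloosterman_real (iotaF b) _.
  exists (fun j => complex.Re (Y j)); split.
  - rewrite RRe_real // /Y /tower_kloosterman !expn0 imF /S.
    rewrite big_imset_cond /=; last by move=> x x' _ _; exact: fmorph_inj.
    apply: eq_big => [x | x _]; first by rewrite inE /= fmorph_eq0.
    rewrite /psiL /ptrace big_ord1 expr1 /kloosterman_arg.
    by rewrite -fmorphV -rmorphM -rmorphD iotaK.
  - move=> j ltj; apply: complexI; rewrite doubleC natC !RRe_real //.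
    exact: (tower_kloosterman_double pq q_gt1 two_neq0 cardL psiLD psiL0 (iotaF u) nu (iotaF b) nb ltj).
  - have := tower_kloosterman_le pq q_gt1 cardL psiLD psiL0 psiLN (iotaF u) nu (iotaF b) nb.
    rewrite -lecR natC; apply: le_trans.
    exact: normc_ge_Re.
have [y [y0 _ _]] := tower 0%N.
have Sreal : S \is Num.real by rewrite -y0; apply/complex_realP; exists (y 0%N).
rewrite real_normK // -y0 -natC -(rmorphXn (real_complex R)) lecR leNgt; apply/negP => lt4.
have q_gt0 : 0 < q%:R :> R by rewrite ltr0n (ltnW q_gt1).
pose delta := y 0%N ^+ 2 / q%:R - 4.
have delta_gt0 : 0 < delta by rewrite subr_gt0 ltr_pdivlMr // -natrM.
(* At this height [2 ^+ m.+1 * delta], hence also [4 ^+ m.+1 * delta], exceeds the fixed Stepanov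
   bound [16 q^2]. *)
pose m := Num.bound (16 * q%:R ^+ 2 / delta).
have : 16 * q%:R ^+ 2 / delta < 2 ^+ m.+1 by apply: upper_nthrootP; rewrite leqW.
have [y' [y'0 yS yle]] := tower m.
have e0 : y' 0%N = y 0%N by apply: complexI; rewrite y'0 y0.
have := @doubling_growth R q m.+1 y' delta (ltnW q_gt1) yS (ltW delta_gt0) _ m.+1 (leqnn _).
rewrite e0 /delta [4 + _]addrC subrK divfK ?lt0r_neq0 // => /(_ (lexx _)).
rewrite -/delta => grow.
have {}grow := le_trans grow (_ : y' m.+1 ^+ 2 <= (16 * q%:R ^+ 2) * (q ^ 2 ^ m.+1)%:R).
have {grow} : 4 + 4 ^+ m.+1 * delta <= 16 * q%:R ^+ 2.
  rewrite -(ler_pM2r (_ : 0 < (q ^ 2 ^ m.+1)%:R)) ?ltr0n ?expn_gt0 ?(ltnW q_gt1) //.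
  apply: grow; rewrite -real_normK ?num_real //.
  apply: le_trans (_ : (4 * q * q ^ 2 ^ m)%:R ^+ 2 <= _).
    by rewrite ler_sqr ?nnegrE.
  have DE : (q ^ 2 ^ m.+1 = q ^ 2 ^ m * q ^ 2 ^ m)%N by rewrite expnS mul2n -addnn expnD.
  by rewrite DE natrM !natrM exprMn exprMn -!natrX -!natrM ler_nat; lia.
rewrite ltr_pdivrMr // => h1 h2.
have : (2 ^+ m.+1 : R) <= 4 ^+ m.+1 by rewrite lerXn2r ?nnegrE // ler_nat.
move/(ler_wpM2r (ltW delta_gt0)); lra.
Qed.

(** * Additive characters and Gauss sums *)

Lemma ex_root_of_unity (C : numClosedFieldType) (p : nat) : prime p ->
  exists2 z : C, z ^+ p = 1 & z != 1.
Proof.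
move=> pr_p; pose P : {poly C} := \sum_(i < p) 'X^i.
have p_gt1 := prime_gt1 pr_p.
have szP : size P = p.
  have -> : P = \poly_(i < p) 1.
    by rewrite poly_def; apply: eq_bigr => i _; rewrite scale1r.
  by rewrite size_poly_eq // oner_eq0.
have /closed_rootP[z rz] : size P != 1%N by rewrite szP; case: (p) p_gt1 => [|[]].
exists z.
  apply/eqP; rewrite -subr_eq0 subrX1; apply/eqP.
  move: rz; rewrite /root /P horner_sum => /eqP rz.
  by rewrite (eq_bigr (fun i : 'I_p => ('X^i).[z])) ?rz ?mulr0 // => i _; rewrite hornerXn.
apply: contraTneq rz => ->; rewrite /root /P horner_sum.
under eq_bigr do rewrite hornerXn expr1n.
by rewrite sumr_const card_ord pnatr_eq0; case: (p) p_gt1.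
Qed.

(** Any nonzero linear form to the prime field, followed by powers of a nontrivial [p]-th root of
    unity, will do. The form here is a coordinate that does not vanish at 1. *)
Lemma ex_character (K : finFieldType) (C : numClosedFieldType) :
  exists psi : K -> C, is_character psi.
Proof.
have [p pr_p pK] := finPcharP K.
have [z zp z1] := ex_root_of_unity C pr_p.
pose V := pPrimeCharType pK.
have [i ci] : exists i, coord (vbasis {:V}) i (1 : V) != 0.
  apply/existsP; rewrite -[X in is_true X]negbK; apply/negP; rewrite negb_exists => /forallP c0.
  have := coord_vbasis (memvf (1 : V)); rewrite big1 => [/eqP|i _]; first by rewrite oner_eq0.
  by move/negPn/eqP: (c0 i) => ->; rewrite scale0r.
pose c (x : V) : 'F_p := coord (vbasis {:V}) i x.
have zmod n : z ^+ (n %% p) = z ^+ n by rewrite {2}(divn_eq n p) exprD mulnC exprM zp expr1n mul1r.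
have valD (a b : 'F_p) : z ^+ (a + b)%R = z ^+ a * z ^+ b.
  by rewrite -exprD -[RHS]zmod /=; congr (_ ^+ modn _ _); exact: Fp_cast.
have cD (x y : K) : z ^+ c (x + y) = z ^+ c x * z ^+ c y.
  by rewrite /c linearD valD.
have norm_z : `|z| = 1.
  apply/eqP; rewrite -(@eqrXn2 _ p) ?normr_ge0 ?prime_gt0 // expr1n -normrX zp.
  by rewrite normr1.
exists (fun x => z ^+ c x); split.
- by rewrite /c linear0.
- exact: cD.
- move=> x; have zz : z ^+ c x != 0.
    by rewrite expf_neq0 // -normr_gt0 norm_z.
  apply: (mulfI zz); rewrite -cD subrr -normCK normrX norm_z !expr1n.
  by rewrite /c linear0.
- exists ((c 1)^-1 *: (1 : V)).
  have -> : c ((c 1)^-1 *: (1 : V)) = 1 by rewrite {1}/c linearZ; exact: mulVf.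
  by rewrite expr1.
Qed.

Lemma sum_by_sqr (K : finFieldType) (M : nmodType) (f : K -> M) (k : K) :
  \sum_v f (k * v ^+ 2) = \sum_a f a *+ #|[set v | k * v ^+ 2 == a]|.
Proof.
rewrite (partition_big (fun v => k * v ^+ 2) xpredT) //=; apply: eq_bigr => a _.
by rewrite -sumr_const; apply: eq_big => [v | v /eqP->]; rewrite ?inE.
Qed.

Section GaussSums.
Variables (K : finFieldType) (C : numClosedFieldType) (psi : K -> C).
Hypotheses (oddK : odd #|K|) (psiP : is_character psi).
Local Notation q := #|K|.

Let psi0 : psi 0 = 1. Proof. by case: psiP. Qed.
Let psiD : {morph psi : x y / x + y >-> x * y}. Proof. by case: psiP. Qed.
Let psiN x : psi (- x) = (psi x)^*. Proof. by case: psiP. Qed.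
Let two_neq0 : 2%:R != 0 :> K. Proof. exact: odd_two_neq0. Qed.

Lemma norm_character x : `|psi x| = 1.
Proof.
apply/eqP; rewrite -(@eqrXn2 _ 2) ?normr_ge0 // expr1n normCK -psiN.
by rewrite -psiD subrr psi0.
Qed.

Lemma sum_character c : \sum_x psi (c * x) = if c == 0 then q%:R else 0.
Proof.
have [->|nzc] := eqVneq c 0.
  by rewrite (eq_bigr (fun=> 1)) ?sumr_const // => x _; rewrite mul0r.
have [_ _ _ [a na]] := psiP.
transitivity (\sum_(x in [set: K]) psi (c * x)); first by apply: eq_bigl => x; rewrite inE.
apply: (@sum_character_eq0 _ _ setT _ (a / c)) => [x y _ _ | x y _ _ | |].
- by rewrite inE.
- by rewrite mulrDr psiD.
- by rewrite inE.
- by rewrite mulrC divfK.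
Qed.

Lemma sum_character_neq0 c :
  \sum_(x | x != 0) psi (x * c) = (if c == 0 then q%:R else 0) - 1.
Proof.
rewrite -sum_character [in RHS](bigD1 0) //= mulr0 psi0 [in RHS]addrAC subrr add0r.
by apply: eq_bigr => x _; rewrite mulrC.
Qed.

Definition gauss_sum (s : K) : C := \sum_v psi (s * v ^+ 2).

(** Writing one variable as [h + w] leaves a phase linear in [w] with slope [2 s h], so only [h = 0]
    survives. *)
Lemma gauss_sum_sqr_norm s : s != 0 -> `|gauss_sum s| ^+ 2 = q%:R.
Proof.
move=> nzs; rewrite normCK {2}/gauss_sum rmorph_sum mulr_sumr.
transitivity (\sum_w \sum_h psi (s * h ^+ 2) * psi ((2%:R * s * h) * w)).
  apply: eq_bigr => w _; rewrite /gauss_sum mulr_suml (reindex_inj (addIr w)).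
  apply: eq_bigr => h _; rewrite /= -psiN -!psiD; congr psi; ring.
rewrite exchange_big (bigD1 0) //= [X in _ + X]big1 ?addr0 => [|h nzh].
  by rewrite -mulr_sumr sum_character mulr0 eqxx expr0n mulr0 psi0 mul1r.
by rewrite -mulr_sumr sum_character !mulf_eq0 (negPf nzh) (negPf nzs) (negPf two_neq0) mulr0.
Qed.

Lemma card_sqr_le2 (k a : K) : k != 0 -> (#|[set v : K | (k * v ^+ 2 == a)%R]| <= 2)%N.
Proof.
move=> nzk; apply: leq_trans (card_quadratic_roots 0 (- (a / k))).
apply/subset_leq_card/subsetP => v; rewrite !inE => /eqP <-.
by rewrite sub0r mulrN mulrAC divff // mul1r expr2.
Qed.

(* The equations [v^2 = a] and [k v^2 = a] together have two solutions. *)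
Lemma card_sqr_nonsquare k a : (forall m, m ^+ 2 != k) ->
  (#|[set v : K | (1 * v ^+ 2 == a)%R]| + #|[set v : K | (k * v ^+ 2 == a)%R]|)%N = 2%N.
Proof.
move=> nsq; have nzk : k != 0 by have := nsq 0; rewrite expr0n eq_sym.
pose n1 a := #|[set v : K | 1 * v ^+ 2 == a]|; pose n2 a := #|[set v : K | k * v ^+ 2 == a]|.
have le2 b : (n1 b + n2 b <= 2)%N.
  case: (set_0Vmem [set v : K | 1 * v ^+ 2 == b]) => [e|[v]].
    by rewrite /n1 e cards0 card_sqr_le2.
  case: (set_0Vmem [set v : K | k * v ^+ 2 == b]) => [e _|[w]].
    by rewrite /n2 e cards0 addn0 card_sqr_le2 ?oner_eq0.
  rewrite !inE mul1r => /eqP wb /eqP vb.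
  have w0 : w = 0.
    apply/eqP/negPn/negP => nzw; have /eqP[] := nsq (v / w).
    by rewrite exprMn exprVn vb -wb mulfK // expf_neq0.
  have b0 : b = 0 by rewrite -wb w0 expr0n mulr0.
  have n0 (c : K) : c != 0 -> #|[set v : K | c * v ^+ 2 == b]| = 1%N.
    move=> nzc; apply: etrans (cards1 (0 : K)); apply: eq_card => x; rewrite !inE b0.
    by rewrite mulf_eq0 (negPf nzc) sqrf_eq0.
  by rewrite /n1 /n2 !n0 ?oner_eq0.
have tot : \sum_b (2%:R - (n1 b + n2 b)%:R : int) = 0.
  have e1 : \sum_(v : K) (1 : int) = \sum_b (n1 b)%:R := sum_by_sqr (fun _ => 1 : int) 1.
  have e2 : \sum_(v : K) (1 : int) = \sum_b (n2 b)%:R := sum_by_sqr (fun _ => 1 : int) k.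
  transitivity (\sum_(b : K) 2%:R - (\sum_b (n1 b)%:R + \sum_b (n2 b)%:R) : int).
    by rewrite -big_split -sumrB; apply: eq_bigr => b _; rewrite natrD.
  by rewrite -e1 -e2 !sumr_const mulrnAC -mulr2n subrr.
have ge0 b : true -> 0 <= (2%:R - (n1 b + n2 b)%:R : int).
  by move=> _; rewrite subr_ge0 ler_nat.
have := psumr_eq0P ge0 tot (erefl : xpredT a).
by rewrite -/(n1 a) -/(n2 a); lia.
Qed.

(** [e] is the quadratic character of [k]. For a square, rescale the variable; otherwise [v^2] and
    [k v^2] together cover every element twice, so the two Gauss sums add up to twice a complete
    character sum. *)
Lemma gauss_sum_scale k : k != 0 ->
  exists2 e : C, e ^+ 2 = 1 & forall s, s != 0 -> gauss_sum (k * s) = e * gauss_sum s.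
Proof.
move=> nzk; have [m /eqP km|nsq] := pickP [pred m | m ^+ 2 == k].
  have nzm : m != 0 by rewrite -sqrf_eq0 km.
  exists 1 => [|s nzs]; first by rewrite expr1n.
  rewrite mul1r /gauss_sum [RHS](reindex_inj (mulfI nzm)); apply: eq_bigr => v _.
  by rewrite exprMn km; congr psi; ring.
exists (-1) => [|s nzs]; first by rewrite sqrrN expr1n.
apply/eqP; rewrite mulN1r -addr_eq0 addrC.
pose f a := psi (s * a).
have -> : gauss_sum s = \sum_v f (1 * v ^+ 2) by apply: eq_bigr => v _; rewrite /f mul1r.
have -> : gauss_sum (k * s) = \sum_v f (k * v ^+ 2).
  by apply: eq_bigr => v _; congr psi; ring.
rewrite !sum_by_sqr -big_split /=.
under eq_bigr => a _.
  rewrite -mulrnDr card_sqr_nonsquare; last by move=> m; apply/negbT/nsq.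
  over.
by rewrite sumrMnl /f sum_character (negPf nzs) mul0rn.
Qed.

End GaussSums.

(** * Twisted Kloosterman sums *)

Section TwistedSums.
Variables (R : realType) (K : finFieldType) (psi : K -> R[i]).
Hypotheses (oddK : odd #|K|) (psiP : is_character psi).
Local Notation q := #|K|.
Local Notation g := (gauss_sum psi).

Let psi0 : psi 0 = 1. Proof. by case: psiP. Qed.
Let psiD : {morph psi : x y / x + y >-> x * y}. Proof. by case: psiP. Qed.
Let two_neq0 : 2%:R != 0 :> K. Proof. exact: odd_two_neq0. Qed.

(** With [u] a quarter of [sqnorm xi], this is the contribution of the nonzero frequencies [s] to
    [q] times the Fourier transform of the sphere at [xi]. *)
Definition twisted_kloosterman (d : nat) (t u : K) : R[i] :=
  \sum_(s | s != 0) psi (- (s * t) - u / s) * g s ^+ d.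

Lemma gauss_sum_even d s : ~~ odd d -> s != 0 -> g s ^+ d = g 1 ^+ d.
Proof.
move=> /even_halfK <- nzs; have [e e2 /(_ 1 (oner_neq0 _))] := gauss_sum_scale oddK psiP nzs.
by rewrite mulr1 => ->; rewrite -mul2n exprMn exprM e2 expr1n mul1r.
Qed.

Lemma gauss_sum_norm s : s != 0 -> `|g s| = `|g 1|.
Proof.
move=> nzs; apply/eqP; rewrite -(@eqrXn2 _ 2) ?normr_ge0 //.
by rewrite !gauss_sum_sqr_norm ?oner_eq0.
Qed.

Lemma gauss_sum_norm_sqrX d s : s != 0 -> (`|g s| ^+ d) ^+ 2 = (q ^ d)%:R.
Proof. by move=> nzs; rewrite exprAC gauss_sum_sqr_norm // natrX. Qed.

Lemma twisted_kloosterman_trivial d t u :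
  `|twisted_kloosterman d t u| ^+ 2 <= (q ^ d.+2)%:R.
Proof.
have le : `|twisted_kloosterman d t u| <= q%:R * `|g 1| ^+ d.
  apply: (le_trans (ler_norm_sum _ _ _)).
  under eq_bigr => s nzs do
    rewrite normrM (norm_character psiP) mul1r normrX gauss_sum_norm //.
  rewrite sumr_const -[leLHS]mulr_natl ler_wpM2r ?exprn_ge0 // ler_nat.
  exact: max_card.
apply: (le_trans (_ : _ <= (q%:R * `|g 1| ^+ d) ^+ 2)).
  by rewrite ler_sqr ?nnegrE // mulr_ge0 ?exprn_ge0.
by rewrite exprMn gauss_sum_norm_sqrX ?oner_eq0 // -natrX -natrM -expnD.
Qed.

(** An even power of a Gauss sum does not depend on [s], and the remaining character sum over
    nonzero [s] is [-1]. The gain of [q^2] over the trivial bound sharpens the case of dimension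
    two. *)
Lemma twisted_kloosterman_even0 d t : ~~ odd d -> t != 0 ->
  `|twisted_kloosterman d t 0| ^+ 2 = (q ^ d)%:R.
Proof.
move=> evd nzt; have -> : twisted_kloosterman d t 0 = - g 1 ^+ d.
  rewrite /twisted_kloosterman; under eq_bigr => s nzs do
    rewrite mul0r subr0 -mulrN gauss_sum_even //.
  by rewrite -mulr_suml sum_character_neq0 // oppr_eq0 (negPf nzt) sub0r mulN1r.
by rewrite normrN normrX gauss_sum_norm_sqrX ?oner_eq0.
Qed.

Lemma twisted_kloosterman_even_le d t u : ~~ odd d -> t != 0 ->
  `|twisted_kloosterman d t u| ^+ 2 <= (4 * q ^ d.+1)%:R.
Proof.
move=> evd nzt; have q_gt0 : (0 < q)%N := ltnW (finField_card_gt1 K).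
have [->|nzu] := eqVneq u 0.
  by rewrite twisted_kloosterman_even0 // ler_nat expnS; nia.
have -> : twisted_kloosterman d t u = (\sum_(x | x != 0) psi (x + u * t / x)) * g 1 ^+ d.
  rewrite mulr_suml /twisted_kloosterman.
  (* The substitution [s = - x / t] produces the Kloosterman argument with [b = u t]. *)
  have nzt' : - t^-1 != 0 by rewrite oppr_eq0 invr_eq0.
  rewrite (reindex_inj (mulfI nzt')); apply: eq_big => [x | x].
    by rewrite mulf_eq0 (negPf nzt').
  move=> nzs; have nzx : x != 0 by move: nzs; rewrite mulf_eq0 negb_or => /andP[].
  rewrite gauss_sum_even //; congr (psi _ * _).
  by field; rewrite nzx nzt oppr_eq0 oner_eq0.
rewrite normrM exprMn normrX gauss_sum_norm_sqrX ?oner_eq0 // expnS mulnA natrM.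
by rewrite ler_wpM2r // kloosterman_sqr_le // mulf_neq0.
Qed.

(* Opening the Gauss sum and completing the square leaves a sum over the square roots of [4 u t]. *)
Lemma salie_sum t u : u != 0 ->
  \sum_(s | s != 0) psi (- (s * t) - u / s) * g ((4%:R * u)^-1 * s) =
  q%:R * \sum_(v | v ^+ 2 == 4%:R * u * t) psi v.
Proof.
move=> nzu.
have nz4 : 4%:R != 0 :> K by rewrite (_ : 4 = 2 * 2)%N // natrM mulf_neq0.
have nz4u : 4%:R * u != 0 by rewrite mulf_neq0.
transitivity (\sum_v psi v * \sum_(s | s != 0) psi (s * (v ^+ 2 / (4%:R * u) - t))).
  under [RHS]eq_bigr => v _ do rewrite mulr_sumr.
  rewrite [RHS]exchange_big; apply: eq_bigr => s nzs /=.
  rewrite /gauss_sum (reindex_inj (addIr (2%:R * u / s))) mulr_sumr.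
  apply: eq_bigr => v _; rewrite -!psiD; congr psi.
  by field; rewrite nzu nz4 nzs.
under eq_bigr => v _ do rewrite sum_character_neq0 // mulrBr mulr1.
rewrite sumrB.
have -> : \sum_v psi v = 0.
  have := sum_character psiP 1; rewrite oner_eq0; apply: etrans.
  by apply: eq_bigr => v _; rewrite mul1r.
rewrite subr0 mulr_sumr [RHS]big_mkcond; apply: eq_bigr => v _.
rewrite subr_eq0 -(inj_eq (mulIf nz4u)) divfK // [t * _]mulrC.
by case: ifP => _; [exact: mulrC | rewrite mulr0].
Qed.

(** For [u = 0] the sum counts square roots of [t]. Otherwise [g s] equals, up to a sign independent
    of [s], the Gauss sum in [salie_sum], and at most two square roots remain. *)
Lemma twisted_kloosterman1_le t u : `|twisted_kloosterman 1 t u| <= (2 * q)%:R.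
Proof.
have card_roots a : (#|[pred v : K | v ^+ 2 == a]| <= 2)%N.
  rewrite -(cardsE [pred v : K | v ^+ 2 == a]).
  apply: leq_trans (card_sqr_le2 a (oner_neq0 K)).
  by apply/subset_leq_card/subsetP => v; rewrite !inE mul1r.
rewrite /twisted_kloosterman; under eq_bigr do rewrite expr1.
have [->|nzu] := eqVneq u 0.
  have -> : \sum_(s | s != 0) psi (- (s * t) - 0 / s) * g s =
      q%:R * (#|[pred v : K | v ^+ 2 == t]|%:R - 1).
    transitivity (\sum_v \sum_(s | s != 0) psi (s * (v ^+ 2 - t))).
      rewrite exchange_big; apply: eq_bigr => s _; rewrite mulr_sumr.
      by apply: eq_bigr => v _; rewrite -psiD mul0r subr0; congr psi; ring.
    under eq_bigr => v _ do rewrite sum_character_neq0 // subr_eq0.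
    rewrite sumrB -big_mkcond /= !sumr_const mulrBr mulr1.
    by rewrite -[X in X - _]mulr_natr.
  rewrite normrM normr_nat mulrC natrM ler_wpM2r //.
  have := card_roots t; case: #|_| => [|[|[|n]]] // _.
  - by rewrite sub0r normrN normr1 ler1n.
  - by rewrite subrr normr0.
  - by rewrite (_ : 2%:R - 1 = 1) ?normr1 ?ler1n // -[2%:R]/(1 + 1) addrK.
have nz4u : (4%:R * u)^-1 != 0.
  by rewrite invr_eq0 mulf_neq0 // (_ : 4 = 2 * 2)%N // natrM mulf_neq0.
have [e e2 gE] := gauss_sum_scale oddK psiP nz4u.
have norm_e : `|e| = 1.
  by apply/eqP; rewrite -(@eqrXn2 _ 2) ?normr_ge0 // expr1n -normrX e2 normr1.
under eq_bigr => s nzs do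
  rewrite -[g s]mul1r -e2 expr2 -[e * e * _]mulrA -gE // mulrCA.
rewrite -mulr_sumr salie_sum // !normrM norm_e mul1r normr_nat mulnC natrM ler_wpM2l //.
apply: (le_trans (ler_norm_sum _ _ _)).
under eq_bigr do rewrite (norm_character psiP).
by rewrite sumr_const ler_nat card_roots.
Qed.

(** For odd [d] the even power [d - 1] of the Gauss sum is constant, which reduces to [d = 1]. *)
Lemma twisted_kloosterman_le d t u : t != 0 ->
  `|twisted_kloosterman d t u| ^+ 2 <= (4 * q ^ d.+1)%:R.
Proof.
move=> nzt; have [oddd|] := boolP (odd d); last by move/twisted_kloosterman_even_le; exact.
case: d oddd => // d /= evd.
have -> : twisted_kloosterman d.+1 t u = g 1 ^+ d * twisted_kloosterman 1 t u.
  rewrite mulr_sumr; apply: eq_bigr => s nzs.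
  by rewrite exprSr gauss_sum_even // mulrCA expr1.
rewrite normrM exprMn normrX gauss_sum_norm_sqrX ?oner_eq0 //.
apply: (le_trans (_ : _ <= (q ^ d)%:R * (2 * q)%:R ^+ 2)).
  by rewrite ler_wpM2l // ler_sqr ?nnegrE // twisted_kloosterman1_le.
rewrite -natrX -natrM ler_nat !expnS expn0 muln1; move: (q ^ d)%N q => a b; nia.
Qed.

End TwistedSums.

(** * Fourier transform of the sphere *)

Definition dotrv (K : pzRingType) (d : nat) (x y : 'rV[K]_d) : K :=
  \sum_(i < d) x ord0 i * y ord0 i.

Lemma sum_prod_rV (K : finFieldType) (C : comPzSemiRingType) (d : nat) (F : 'I_d -> K -> C) :
  \sum_(x : 'rV[K]_d) \prod_(i < d) F i (x ord0 i) = \prod_(i < d) \sum_v F i v.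
Proof.
rewrite bigA_distr_bigA /=.
rewrite (reindex (fun h : {ffun 'I_d -> K} => \row_i h i)) /=.
  by apply: eq_bigr => h _; apply: eq_bigr => i _; rewrite mxE.
exists (fun x : 'rV[K]_d => [ffun i => x ord0 i]) => [h _ | x _].
  by apply/ffunP => i; rewrite ffunE mxE.
by apply/rowP => i; rewrite mxE ffunE.
Qed.

Section Fourier.
Variables (K : finFieldType) (C : numClosedFieldType) (psi : K -> C) (d : nat).
Hypotheses (psiP : is_character psi).
Local Notation q := #|K|.
Local Notation V := 'rV[K]_d.

Let psi0 : psi 0 = 1. Proof. by case: psiP. Qed.
Let psiD : {morph psi : x y / x + y >-> x * y}. Proof. by case: psiP. Qed.
Let psiN x : psi (- x) = (psi x)^*. Proof. by case: psiP. Qed.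

Lemma character_sum (I : Type) (s : seq I) (P : pred I) (F : I -> K) :
  psi (\sum_(i <- s | P i) F i) = \prod_(i <- s | P i) psi (F i).
Proof. exact: (big_morph psi psiD psi0). Qed.

Lemma sum_character_rV (xi : V) :
  \sum_x psi (dotrv xi x) = if xi == 0 then (q ^ d)%:R else 0.
Proof.
under eq_bigr => x _ do rewrite character_sum.
rewrite (sum_prod_rV (fun i v => psi (xi ord0 i * v))).
under eq_bigr => i _ do rewrite sum_character //.
have [->|/rV0Pn[i nzi]] := eqVneq.
  under eq_bigr => i _ do rewrite mxE eqxx.
  by rewrite prodr_const card_ord natrX.
by rewrite (bigD1 i) //= (negPf nzi) mul0r.
Qed.

Definition fourier (u : V -> C) (xi : V) : C := \sum_x u x * psi (dotrv xi x).

Lemma parseval u : \sum_xi `|fourier u xi| ^+ 2 = (q ^ d)%:R * \sum_x `|u x| ^+ 2.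
Proof.
transitivity (\sum_x \sum_y u x * (u y)^* * \sum_xi psi (dotrv (x - y) xi)).
  under eq_bigr => xi _ do rewrite normCK {2}/fourier rmorph_sum mulr_sumr.
  rewrite exchange_big /=.
  under eq_bigr => y _ do under eq_bigr => xi _ do rewrite /fourier mulr_suml.
  under eq_bigr => y _ do rewrite exchange_big /=.
  rewrite exchange_big; apply: eq_bigr => x _; apply: eq_bigr => y _.
  rewrite mulr_sumr; apply: eq_bigr => xi _; rewrite rmorphM /= mulrACA -psiN -psiD.
  congr (_ * psi _); rewrite /dotrv -sumrB; apply: eq_bigr => i _.
  by rewrite !mxE; ring.
rewrite mulr_sumr; apply: eq_bigr => x _.
rewrite (bigD1 x) //= [X in _ + X]big1 ?addr0 => [|y ney].
  by rewrite sum_character_rV subrr eqxx mulrC normCK.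
by rewrite sum_character_rV subr_eq0 eq_sym (negPf ney) mulr0.
Qed.

Definition convol (h u : V -> C) (x : V) : C := \sum_z h (x - z) * u z.

Lemma dotrvD (xi x y : V) : dotrv xi (x + y) = dotrv xi x + dotrv xi y.
Proof. by rewrite /dotrv -big_split; apply: eq_bigr => i _; rewrite mxE mulrDr. Qed.

Lemma fourier_convol h u xi : fourier (convol h u) xi = fourier h xi * fourier u xi.
Proof.
rewrite {1}/fourier /convol; under eq_bigr => x _ do rewrite mulr_suml.
rewrite exchange_big mulr_sumr; apply: eq_bigr => z _.
rewrite (reindex_inj (addIr z)) mulr_suml; apply: eq_bigr => x _ /=.
by rewrite addrK dotrvD psiD; ring.
Qed.

Lemma convol_l2_le h u (M : C) : (forall xi, `|fourier h xi| ^+ 2 <= M) ->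
  \sum_x `|convol h u x| ^+ 2 <= M * \sum_x `|u x| ^+ 2.
Proof.
move=> leM; have N_gt0 : 0 < (q ^ d)%:R :> C.
  by rewrite ltr0n expn_gt0 (ltnW (finField_card_gt1 K)).
rewrite -(ler_pM2l N_gt0) -parseval mulrCA -parseval mulr_sumr.
apply: ler_sum => xi _; rewrite fourier_convol normrM exprMn.
by rewrite ler_wpM2r ?exprn_ge0.
Qed.

End Fourier.

Section Sphere.
Variables (R : realType) (K : finFieldType) (psi : K -> R[i]) (d : nat) (t : K).
Hypotheses (oddK : odd #|K|) (psiP : is_character psi).
Local Notation q := #|K|.
Local Notation V := 'rV[K]_d.
Local Notation C := R[i].

Let psi0 : psi 0 = 1. Proof. by case: psiP. Qed.
Let psiD : {morph psi : x y / x + y >-> x * y}. Proof. by case: psiP. Qed.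
Let q_gt0 : (0 < q)%N. Proof. exact: ltnW (finField_card_gt1 K). Qed.
Let q_neq0 : q%:R != 0 :> C. Proof. by rewrite pnatr_eq0 -lt0n. Qed.

Definition sphere_transform (xi : V) : C := \sum_(x | sqnorm x == t) psi (dotrv xi x).

Lemma quadratic_character_sum (s a : K) : s != 0 ->
  \sum_v psi (s * v ^+ 2 + a * v) = psi (- (a ^+ 2 / (4%:R * s))) * gauss_sum psi s.
Proof.
move=> nzs; have nz2 := odd_two_neq0 oddK.
have nz4 : 4%:R != 0 :> K by rewrite (_ : 4 = 2 * 2)%N // natrM mulf_neq0.
rewrite (reindex_inj (addIr (- (a / (2%:R * s))))) mulr_sumr; apply: eq_bigr => v _.
by rewrite -psiD; congr psi; field; rewrite nzs nz4 nz2.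
Qed.

(** The sphere is detected by summing [psi (s * (sqnorm x - t))] over [s]. Frequency 0 gives the
    mass at the origin; for the others the sum factors over the coordinates, where squares are
    completed. *)
Lemma sphere_transformE (xi : V) :
  q%:R * sphere_transform xi =
  (if xi == 0 then (q ^ d)%:R else 0) + twisted_kloosterman psi d t (sqnorm xi / 4%:R).
Proof.
transitivity (\sum_s \sum_(x : V) psi (s * (sqnorm x - t)) * psi (dotrv xi x)).
  rewrite exchange_big mulr_sumr big_mkcond; apply: eq_bigr => x _ /=.
  rewrite -mulr_suml; under eq_bigr => s _ do rewrite mulrC.
  rewrite (sum_character psiP) subr_eq0.
  by case: ifP => _; rewrite ?mul0r.
rewrite (bigD1 0) //=; congr (_ + _).
  by under eq_bigr => x _ do rewrite mul0r psi0 mul1r; exact: sum_character_rV.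
apply: eq_bigr => s nzs.
transitivity (psi (- (s * t)) * \sum_(x : V) \prod_i psi (s * x ord0 i ^+ 2 + xi ord0 i * x ord0 i)).
  rewrite mulr_sumr; apply: eq_bigr => x _.
  rewrite -(character_sum psiP) -!psiD; congr psi.
  by rewrite big_split /= -mulr_sumr /dotrv /sqnorm; ring.
rewrite (sum_prod_rV (fun i v => psi (s * v ^+ 2 + xi ord0 i * v))).
under eq_bigr => i _ do rewrite quadratic_character_sum //.
rewrite big_split /= prodr_const card_ord mulrA; congr (_ * _).
rewrite -(character_sum psiP) -psiD; congr psi; congr (_ + _).
rewrite sumrN; congr (- _); rewrite /sqnorm !mulr_suml; apply: eq_bigr => i _.
by rewrite invfM mulrA.
Qed.

Definition sphere_card : nat := #|[pred x : V | sqnorm x == t]|.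

Lemma sphere_transform0 : sphere_transform 0 = sphere_card%:R.
Proof.
rewrite /sphere_transform (eq_bigr (fun=> 1)) ?sumr_const // => x _.
by rewrite /dotrv big1 ?psi0 // => i _; rewrite mxE mul0r.
Qed.

Lemma sphere_card_twisted :
  q%:R * (sphere_card%:R - q%:R ^+ d / q%:R) = twisted_kloosterman psi d t 0.
Proof.
have := sphere_transformE 0; rewrite eqxx sphere_transform0.
have -> : sqnorm (0 : V) = 0 by rewrite /sqnorm big1 // => i _; rewrite mxE expr0n.
rewrite mul0r mulrBr => ->; rewrite natrX [q%:R * _]mulrC divfK //.
by rewrite addrC addKr.
Qed.

Definition sphere_error (x : V) : C :=
  (sqnorm x == t)%:R - sphere_card%:R / q%:R ^+ d.

Lemma fourier_sphere_error (xi : V) :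
  fourier psi sphere_error xi = if xi == 0 then 0 else sphere_transform xi.
Proof.
rewrite /fourier /sphere_error; under eq_bigr => x _ do rewrite mulrBl.
rewrite sumrB -mulr_sumr (sum_character_rV psiP).
have -> : \sum_(x : V) (sqnorm x == t)%:R * psi (dotrv xi x) = sphere_transform xi.
  rewrite [RHS]big_mkcond; apply: eq_bigr => x _.
  by case: ifP => _; rewrite ?mul0r ?mul1r.
have [->|_] := eqVneq; last by rewrite mulr0 subr0.
by rewrite sphere_transform0 natrX divfK ?expf_neq0 ?subrr.
Qed.

Lemma fourier_sphere_error_le (xi : V) : t != 0 -> (0 < d)%N ->
  `|fourier psi sphere_error xi| ^+ 2 <= (4 * q ^ d.-1)%:R.
Proof.
move=> nzt d_gt0; rewrite fourier_sphere_error.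
have [_|nz] := eqVneq; first by rewrite normr0 expr0n.
have := twisted_kloosterman_le oddK psiP d (sqnorm xi / 4%:R) nzt.
have := sphere_transformE xi; rewrite (negPf nz) add0r => <-.
have -> : (4 * q ^ d.+1 = q ^ 2 * (4 * q ^ d.-1))%N.
  by rewrite mulnCA -expnD add2n prednK.
rewrite normrM normr_nat exprMn natrM natrX ler_pM2l // exprn_gt0 // ltr0n.
exact: q_gt0.
Qed.

End Sphere.

(** * Norm of the error operator and size of the sphere, over the reals *)

Section RealSphere.
Variables (R : realType) (K : finFieldType) (d : nat) (t : K).
Hypotheses (oddK : odd #|K|) (t_neq0 : t != 0).
Local Notation q := #|K|.
Local Notation V := 'rV[K]_d.
Local Notation S := (@sphere_card K d t).

Let q_gt0 : (0 < q)%N. Proof. exact: ltnW (finField_card_gt1 K). Qed.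

Let natC n : (n%:R : R)%:C%C = n%:R. Proof. by rewrite rmorph_nat. Qed.

Lemma sqr_norm_real_complex (a : R) : `|a%:C%C| ^+ 2 = (a ^+ 2)%:C%C.
Proof. by rewrite real_normK ?rmorphXn //; apply/complex_realP; exists a. Qed.

Definition sphere_kernel (x : V) : R := (sqnorm x == t)%:R - S%:R / q%:R ^+ d.

Lemma sphere_kernelC x : (sphere_kernel x)%:C%C = sphere_error R t x.
Proof.
by rewrite /sphere_kernel /sphere_error rmorphB fmorph_div rmorphXn /= !natC.
Qed.

Lemma sphere_kernel_l2 (u : V -> R) : (0 < d)%N ->
  \sum_x (\sum_z sphere_kernel (x - z) * u z) ^+ 2 <= (4 * q ^ d.-1)%:R * \sum_x u x ^+ 2.
Proof.
move=> d_gt0; have [psi psiP] := ex_character K R[i].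
have := convol_l2_le psiP (fun x => (u x)%:C%C) (fun xi =>
  fourier_sphere_error_le oddK psiP xi t_neq0 d_gt0).
under eq_bigr => x _.
  have -> : convol (sphere_error R t) (fun z => (u z)%:C%C) x =
      (\sum_z sphere_kernel (x - z) * u z)%:C%C.
    rewrite rmorph_sum; apply: eq_bigr => z _.
    by rewrite rmorphM /= sphere_kernelC.
  rewrite sqr_norm_real_complex; over.
under [X in _ <= _ * X]eq_bigr do rewrite sqr_norm_real_complex.
by rewrite -!(rmorph_sum (real_complex R)) /= -natC -rmorphM lecR.
Qed.

(** [q] times the deviation is a twisted sum at [u = 0], whence the exponent [n.+2]. It serves with
    [n = d] in general and with [n = 0] in the plane. *)
Lemma sphere_card_sqr_le (n : nat) :
  (forall psi : K -> R[i], is_character psi ->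
     `|twisted_kloosterman psi d t 0| ^+ 2 <= (q ^ n.+2)%:R) ->
  (S%:R - q%:R ^+ d / q%:R) ^+ 2 <= (q ^ n)%:R :> R.
Proof.
move=> le; have [psi psiP] := ex_character K R[i].
have := le psi psiP; rewrite -(sphere_card_twisted d t oddK psiP).
have -> : q%:R * (S%:R - q%:R ^+ d / q%:R) =
    (q%:R * (S%:R - q%:R ^+ d / q%:R) : R)%:C%C.
  by rewrite rmorphM rmorphB fmorph_div rmorphXn /= !natC.
rewrite sqr_norm_real_complex -natC lecR exprMn.
rewrite (_ : q ^ n.+2 = q ^ 2 * q ^ n)%N; last by rewrite -expnD.
rewrite natrM [(q ^ 2)%:R]natrX.
by rewrite ler_pM2l // exprn_gt0 // ltr0n.
Qed.

Lemma sphere_card_dev : (S%:R - q%:R ^+ d / q%:R) ^+ 2 <= (q ^ d)%:R :> R.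
Proof.
by apply: sphere_card_sqr_le => psi psiP; exact: twisted_kloosterman_trivial.
Qed.

Lemma sphere_card_dev2 : d = 2%N -> (S%:R - q%:R ^+ d / q%:R) ^+ 2 <= 1 :> R.
Proof.
move=> d2; rewrite -[1]/(q ^ 0)%:R; apply: sphere_card_sqr_le => psi psiP.
by rewrite d2 twisted_kloosterman_even0.
Qed.

End RealSphere.

(** * Bilinear forms in the sphere kernel *)

(** Lagrange's identity: twice the defect is a sum of squares. *)
Lemma cauchy_schwarz (R : realFieldType) (I : finType) (a b : I -> R) :
  (\sum_i a i * b i) ^+ 2 <= (\sum_i a i ^+ 2) * (\sum_i b i ^+ 2).
Proof.
rewrite -subr_ge0 -(pmulrn_lge0 _ (isT : (0 < 2)%N)).
have -> : ((\sum_i a i ^+ 2) * (\sum_i b i ^+ 2) - (\sum_i a i * b i) ^+ 2) *+ 2 =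
    \sum_i \sum_j (a i * b j - a j * b i) ^+ 2.
  transitivity (\sum_i \sum_j (a i ^+ 2 * b j ^+ 2 + a j ^+ 2 * b i ^+ 2
      - (a i * b i * (a j * b j)) *+ 2)).
    under [RHS]eq_bigr => i _ do
      rewrite sumrB big_split /= -mulr_sumr -mulr_suml sumrMnl -mulr_sumr.
    rewrite sumrB big_split /= -mulr_suml -mulr_sumr sumrMnl -mulr_suml.
    by ring.
  by apply: eq_bigr => i _; apply: eq_bigr => j _; ring.
by apply: sumr_ge0 => i _; apply: sumr_ge0 => j _; exact: sqr_ge0.
Qed.

Lemma cauchy_schwarz_sqrt (R : rcfType) (I : finType) (a b : I -> R) :
  `|\sum_i a i * b i| <= Num.sqrt (\sum_i a i ^+ 2) * Num.sqrt (\sum_i b i ^+ 2).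
Proof.
have ge0 (c : I -> R) : 0 <= \sum_i c i ^+ 2 by apply: sumr_ge0 => i _; exact: sqr_ge0.
rewrite -ler_sqr ?nnegrE ?mulr_ge0 ?sqrtr_ge0 // real_normK ?num_real //.
by rewrite exprMn !sqr_sqrtr ?cauchy_schwarz.
Qed.

Section Decomposition.
Variables (R : realType) (K : finFieldType) (d : nat) (t : K).
Hypotheses (oddK : odd #|K|) (t_neq0 : t != 0) (d_gt0 : (0 < d)%N).
Local Notation q := #|K|.
Local Notation V := 'rV[K]_d.
Local Notation E := (@sphere_kernel R K d t).
Local Notation density := ((@sphere_card K d t)%:R / q%:R ^+ d : R).

Definition kernel_op (u : V -> R) (x : V) : R := \sum_z E (x - z) * u z.

Lemma sphere_kernelN x : E (- x) = E x.
Proof.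
rewrite /sphere_kernel; congr (_%:R - _); congr (_ == t).
by apply: eq_bigr => i _; rewrite mxE sqrrN.
Qed.

Lemma kernel_opE (u : V -> R) x : kernel_op u x = \sum_z E (z - x) * u z.
Proof. by apply: eq_bigr => z _; rewrite -sphere_kernelN opprB. Qed.

Lemma l2normE (T : finType) (h : T -> R) : l2norm h = Num.sqrt (\sum_x h x ^+ 2).
Proof. by congr Num.sqrt; apply: eq_bigr => x _; rewrite real_normK ?num_real. Qed.

Lemma l2norm_ge0 (T : finType) (h : T -> R) : 0 <= l2norm h.
Proof. exact: sqrtr_ge0. Qed.

Let lam : R := Num.sqrt (4 * q ^ d.-1)%:R.

Lemma kernel_op_l2norm u : l2norm (kernel_op u) <= lam * l2norm u.
Proof.
by rewrite !l2normE -sqrtrM ?ler0n // ler_wsqrtr // sphere_kernel_l2.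
Qed.

Lemma kernel_form_le u v :
  `|\sum_x u x * kernel_op v x| <= lam * (l2norm u * l2norm v).
Proof.
apply: (le_trans (cauchy_schwarz_sqrt _ _)); rewrite -!l2normE mulrCA.
by rewrite ler_wpM2l ?l2norm_ge0 ?kernel_op_l2norm.
Qed.

Lemma kernel_op_fiber_l2norm (I : finType) (h : I -> V -> R) :
  Num.sqrt (\sum_(p : V * I) kernel_op (h p.2) p.1 ^+ 2) <=
  lam * Num.sqrt (\sum_(p : V * I) h p.2 p.1 ^+ 2).
Proof.
rewrite -sqrtrM ?ler0n // ler_wsqrtr //.
have fubini (F : V -> I -> R) : \sum_(p : V * I) F p.1 p.2 = \sum_i \sum_x F x i.
  by rewrite exchange_big pair_bigA.
rewrite (fubini (fun x i => kernel_op (h i) x ^+ 2)) (fubini (fun x i => h i x ^+ 2)).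
rewrite mulr_sumr; apply: ler_sum => i _; exact: sphere_kernel_l2.
Qed.

(** The form is an inner product over the pairs [(z, y)]: [E] applied to [f] in its first variable,
    against [E] applied to [g] in its second. Cauchy-Schwarz then costs one factor [lam] on each
    side. *)
Lemma kernel_tensor_form_le (f g : V * V -> R) :
  `|\sum_x \sum_y \sum_z \sum_w f (x, y) * g (z, w) * (E (x - z) * E (w - y))| <=
  lam ^+ 2 * (l2norm f * l2norm g).
Proof.
have -> : \sum_x \sum_y \sum_z \sum_w f (x, y) * g (z, w) * (E (x - z) * E (w - y)) =
    \sum_(p : V * V) kernel_op (fun x => f (x, p.2)) p.1 * kernel_op (fun w => g (p.1, w)) p.2.
  rewrite -(pair_bigA _ (fun z y => kernel_op (fun x => f (x, y)) z * kernel_op (fun w => g (z, w)) y)).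
  rewrite [LHS]exchange_big /=; under [LHS]eq_bigr => y _ do rewrite exchange_big /=.
  rewrite [LHS]exchange_big; apply: eq_bigr => z _; apply: eq_bigr => y _.
  rewrite !kernel_opE mulr_suml; apply: eq_bigr => x _.
  by rewrite mulr_sumr; apply: eq_bigr => w _; ring.
apply: (le_trans (cauchy_schwarz_sqrt _ _)).
have swap (F : V -> V -> R) : \sum_(p : V * V) F p.1 p.2 = \sum_(p : V * V) F p.2 p.1.
  by rewrite -(pair_bigA _ F) exchange_big pair_bigA.
have hf := kernel_op_fiber_l2norm (fun y x => f (x, y)).
have hg := kernel_op_fiber_l2norm (fun z w => g (z, w)).
rewrite (swap (fun z y => kernel_op (fun w => g (z, w)) y ^+ 2)) expr2 mulrACA.
have nf : l2norm f = Num.sqrt (\sum_(p : V * V) f (p.1, p.2) ^+ 2).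
  by rewrite l2normE; congr Num.sqrt; apply: eq_bigr => -[].
have ng : l2norm g = Num.sqrt (\sum_(p : V * V) g (p.2, p.1) ^+ 2).
  rewrite l2normE -(swap (fun z w => g (z, w) ^+ 2)).
  by congr Num.sqrt; apply: eq_bigr => -[].
by rewrite nf ng ler_pM ?sqrtr_ge0.
Qed.

Lemma distance_sum_decomposition (f g : V * V -> R) :
  distance_sum t f g =
  density ^+ 2 * ((\sum_p f p) * (\sum_p g p)) +
  density * (\sum_x marginal1 f x * kernel_op (marginal1 g) x +
             \sum_y marginal2 f y * kernel_op (marginal2 g) y) +
  \sum_x \sum_y \sum_z \sum_w f (x, y) * g (z, w) * (E (x - z) * E (w - y)).
Proof.
pose Sum (h : V -> V -> V -> V -> R) := \sum_x \sum_y \sum_z \sum_w f (x, y) * g (z, w) * h x y z w.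
have SumD h1 h2 : Sum (fun x y z w => h1 x y z w + h2 x y z w) = Sum h1 + Sum h2.
  do 4!(rewrite -big_split; apply: eq_bigr => ? _).
  exact: mulrDr.
have SumZ a h : Sum (fun x y z w => a * h x y z w) = a * Sum h.
  do 4!(rewrite mulr_sumr; apply: eq_bigr => ? _).
  exact: mulrCA.
have -> : distance_sum t f g = Sum (fun x y z w => density ^+ 2 * 1 +
    density * (E (x - z) + E (w - y)) + E (x - z) * E (w - y)).
  do 3!(apply: eq_bigr => ? _); rewrite big_mkcond; apply: eq_bigr => w _ /=.
  rewrite /sphere_kernel; set c := density.
  by case: (_ == t); case: (_ == t) => /=; ring.
rewrite !SumD !SumZ SumD; congr (_ * _ + _ * (_ + _) + _).
- have sum_pair (h : V * V -> R) : \sum_p h p = \sum_x \sum_y h (x, y).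
    by rewrite pair_bigA; apply: eq_bigr => -[].
  rewrite !sum_pair; do 2!(rewrite mulr_suml; apply: eq_bigr => ? _).
  do 2!(rewrite mulr_sumr; apply: eq_bigr => ? _).
  exact: mulr1.
- apply: eq_bigr => x _; rewrite mulr_suml; apply: eq_bigr => y _.
  rewrite mulr_sumr; apply: eq_bigr => z _; rewrite mulrA mulr_sumr.
  by apply: eq_bigr => w _; rewrite mulrAC.
- rewrite /Sum exchange_big; apply: eq_bigr => y _; rewrite mulr_suml; apply: eq_bigr => x _.
  rewrite exchange_big kernel_opE mulr_sumr; apply: eq_bigr => w _.
  by rewrite mulrA mulr_sumr; apply: eq_bigr => z _; rewrite mulrAC.
Qed.

End Decomposition.

(** * Density of the sphere and the final estimate *)

Lemma sqrt_exprn_powR (R : realType) (x : R) (n : nat) : 0 <= x ->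
  Num.sqrt (x ^+ n) = x `^ (n%:R / 2).
Proof.
by move=> x_ge0; rewrite -powR12_sqrt ?exprn_ge0 // -powR_mulrn // -powRrM.
Qed.

Section Bound.
Variables (R : realType) (K : finFieldType) (d : nat) (t : K).
Hypotheses (oddK : odd #|K|) (t_neq0 : t != 0) (d_ge2 : (2 <= d)%N).
Local Notation q := (#|K|%:R : R).
Local Notation V := 'rV[K]_d.
Let density : R := (@sphere_card K d t)%:R / q ^+ d.

Let q_gt0 : 0 < q. Proof. by rewrite ltr0n (ltnW (finField_card_gt1 K)). Qed.
Let q_ge1 : 1 <= q. Proof. by rewrite ler1n (ltnW (finField_card_gt1 K)). Qed.
Let q_neq0 : q != 0. Proof. exact: lt0r_neq0. Qed.

Let densityB : density - q^-1 = ((@sphere_card K d t)%:R - q ^+ d / q) / q ^+ d.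
Proof. by rewrite mulrBl /density mulrAC divff ?mul1r // expf_neq0. Qed.

Lemma density_dev : `|density - q^-1| <= Num.sqrt (q ^- d).
Proof.
rewrite -ler_sqr ?nnegrE ?sqrtr_ge0 // real_normK ?num_real //.
rewrite sqr_sqrtr ?invr_ge0 ?exprn_ge0 ?(ltW q_gt0) // densityB expr_div_n.
rewrite ler_pdivrMr ?exprn_gt0 // [(q ^+ d) ^+ 2]expr2 mulKf ?expf_neq0 //.
by have := sphere_card_dev R d t oddK; rewrite natrX.
Qed.

Lemma density_dev2 : d = 2%N -> `|density - q^-1| <= q ^- 2.
Proof.
move=> d2; have := sphere_card_dev2 R oddK t_neq0 d2.
rewrite densityB normrM normfV [`|q ^+ d|]ger0_norm ?exprn_ge0 ?(ltW q_gt0) //.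
move=> le1; have -> : q ^- 2 = 1 * (q ^+ d)^-1 by rewrite mul1r d2.
rewrite ler_wpM2r ?invr_ge0 ?exprn_ge0 ?(ltW q_gt0) //.
by rewrite -ler_sqr ?nnegrE // expr1n real_normK ?num_real.
Qed.

Lemma density_le : density <= 2 / q.
Proof.
have : `|density - q^-1| <= q^-1.
  apply: (le_trans density_dev).
  rewrite -[leRHS]ger0_norm ?invr_ge0 ?(ltW q_gt0) // -sqrtr_sqr exprVn.
  by rewrite ler_wsqrtr // lef_pV2 ?posrE ?exprn_gt0 // ler_weXn2l.
by rewrite ler_norml; lra.
Qed.

Let density_ge0 : 0 <= density.
Proof. by rewrite divr_ge0 ?exprn_ge0 ?(ltW q_gt0). Qed.

(** The other factor [density + 1 / q] is at most [3 / q]: the constant 3 of the theorem. *)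
Lemma density_sqr_dev : `|density ^+ 2 - q ^- 2| <= `|density - q^-1| * (3 / q).
Proof.
rewrite -exprVn subr_sqr normrM ler_wpM2l // ger0_norm.
  by have := density_le; lra.
by rewrite addr_ge0 ?invr_ge0 ?(ltW q_gt0).
Qed.

(** A factor [2 / q] from the density and [2 q^((d-1)/2)] from the operator norm. *)
Lemma density_op_le :
  density * Num.sqrt (4 * #|K| ^ d.-1)%:R <= 4 * q `^ ((d%:R - 3) / 2).
Proof.
rewrite natrM sqrtrM // natrX sqrt_exprn_powR ?(ltW q_gt0) //.
have -> : Num.sqrt (4%:R : R) = 2.
  by rewrite (_ : 4%:R = 2 ^+ 2) ?sqrtr_sqr ?ger0_norm // -natrX.
apply: (le_trans (ler_wpM2r _ density_le)); first by rewrite mulr_ge0 ?powR_ge0.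
have -> : q `^ ((d%:R - 3) / 2) = q^-1 * q `^ (d.-1%:R / 2).
  rewrite -(powR_inv1 (ltW q_gt0)) -powRD; last by rewrite q_neq0 implybT.
  congr (_ `^ _); rewrite -subn1 natrB ?(ltnW d_ge2) //; lra.
by lra.
Qed.

(** [kappa] isolates the one estimate in which the plane differs from general dimension, so that
    both inequalities follow. *)
Lemma distance_sum_le (f g : V * V -> R) (kappa : R) :
  (forall p, 0 <= f p) -> (forall p, 0 <= g p) -> `|density ^+ 2 - q ^- 2| <= kappa ->
  `| distance_sum t f g - q ^- 2 * l1norm f * l1norm g |
     <= kappa * l1norm f * l1norm g
        + 4 * q ^+ (d - 1) * l2norm f * l2norm g
        + 4 * q `^ ((d%:R - 3) / 2)
            * (l2norm (marginal1 f) * l2norm (marginal1 g)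
               + l2norm (marginal2 f) * l2norm (marginal2 g)).
Proof.
move=> f_ge0 g_ge0 le_kappa; have d_gt0 := ltnW d_ge2.
have l1E (h : V * V -> R) : (forall p, 0 <= h p) -> l1norm h = \sum_p h p.
  by move=> h_ge0; apply: eq_bigr => p _; rewrite ger0_norm.
have l1_ge0 (h : V * V -> R) : 0 <= l1norm h by apply: sumr_ge0.
rewrite distance_sum_decomposition -!l1E // -/density.
have le1 := kernel_form_le oddK t_neq0 d_gt0 (marginal1 f) (marginal1 g).
have le2 := kernel_form_le oddK t_neq0 d_gt0 (marginal2 f) (marginal2 g).
have := kernel_tensor_form_le oddK t_neq0 d_gt0 f g.
rewrite sqr_sqrtr ?ler0n // natrM natrX -subn1.
move: (\sum_x \sum_y \sum_z _) => T3 le3.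
move: (\sum_x _) (\sum_x _) le1 le2 => T2 T1 le1 le2.
have -> : density ^+ 2 * (l1norm f * l1norm g) + density * (T1 + T2) + T3
    - q ^- 2 * l1norm f * l1norm g =
  (density ^+ 2 - q ^- 2) * (l1norm f * l1norm g) + T3 + density * (T1 + T2) by ring.
apply: (le_trans (ler_normD _ _)); apply: lerD.
  apply: (le_trans (ler_normD _ _)); apply: lerD; last by rewrite -[leRHS]mulrA.
  by rewrite normrM -mulrA [`|l1norm f * _|]ger0_norm ?mulr_ge0 // ler_wpM2r ?mulr_ge0.
rewrite normrM ger0_norm //.
apply: (le_trans (ler_wpM2l density_ge0 (le_trans (ler_normD _ _) (lerD le1 le2)))).
rewrite -mulrDr mulrA ler_wpM2r ?density_op_le //.
by rewrite addr_ge0 // mulr_ge0 ?l2norm_ge0.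
Qed.

End Bound.

Theorem theorem3p1 (R : realType) (K : finFieldType) (d : nat) (t : K)
    (f g : 'rV[K]_d * 'rV[K]_d -> R)
    (hodd : odd #|K|) (hd : (2 <= d)%N) (ht : t != 0)
    (hf : forall p, 0 <= f p) (hg : forall p, 0 <= g p) :
  let q : R := #|K|%:R in
  let F := marginal1 f in
  let G := marginal1 g in
  let F' := marginal2 f in
  let G' := marginal2 g in
  (`| distance_sum t f g - q ^- 2 * l1norm f * l1norm g |
     <= 3 * q `^ (- ((d%:R + 2) / 2)) * l1norm f * l1norm g
        + 4 * q ^+ (d - 1) * l2norm f * l2norm g
        + 4 * q `^ ((d%:R - 3) / 2)
            * (l2norm F * l2norm G + l2norm F' * l2norm G'))
  /\
  (d = 2%N ->
   `| distance_sum t f g - q ^- 2 * l1norm f * l1norm g |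
     <= 3 * q ^- 3 * l1norm f * l1norm g
        + 4 * q * l2norm f * l2norm g
        + 4 * q `^ (- (1 / 2))
            * (l2norm F * l2norm G + l2norm F' * l2norm G')).
Proof.
move=> q F G F' G'.
have q_gt0 : 0 < q by rewrite ltr0n (ltnW (finField_card_gt1 K)).
have q_neq0 : q != 0 := lt0r_neq0 q_gt0.
have dev := density_sqr_dev R t hodd hd.
split.
  apply: distance_sum_le => //; apply: (le_trans dev).
  (* The deviation [q^(-d/2)] of the density times the [1 / q] left in [dev]. *)
  have -> : q `^ (- ((d%:R + 2) / 2)) = Num.sqrt (q ^- d) * q^-1.
    rewrite sqrtrV ?exprn_ge0 ?(ltW q_gt0) // sqrt_exprn_powR ?(ltW q_gt0) // -powRN.
    rewrite -(powR_inv1 (ltW q_gt0)) -powRD; last by rewrite q_neq0 implybT.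
    by congr (_ `^ _); lra.
  rewrite [leRHS]mulrCA ler_wpM2r ?divr_ge0 ?(ltW q_gt0) //.
  exact: density_dev.
move=> d2.
have -> : 4 * q = 4 * q ^+ (d - 1) by rewrite d2 expr1.
have -> : - (1 / 2) = (d%:R - 3) / 2 :> R by rewrite d2; lra.
apply: distance_sum_le => //; apply: (le_trans dev).
(* In the plane the deviation is [q^-2] instead of the general [q^-1]. *)
have -> : 3 * q ^- 3 = q ^- 2 * (3 / q) by rewrite exprS invfM; ring.
by rewrite ler_wpM2r ?divr_ge0 ?(ltW q_gt0) // density_dev2.
Qed.
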